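(* Let $A$ be a semiperfect noetherian ring with Jacobson radical $J$. Then $$\operatorname{inj\,dim}_A J=\operatorname{gl\,dim} A .$$ In particular $\operatorname{inj\,dim}_A J=\operatorname{inj\,dim}_{A^{\mathrm{op}}} J$.
   Context: Rings are associative with unit; noetherian means left and right noetherian. A ring $A$ is semiperfect if every finitely generated (left or right) $A$-module has a projective cover. Modules are left modules unless stated otherwise; $A^{\mathrm{op}}$ is the opposite ring, so $\operatorname{inj\,dim}_{A^{\mathrm{op}}}J$ is the injective dimension of $J$ as a right $A$-module. Dimensions take values in $\{0,1,2,\dots\}\cup\{\infty\}$, and the zero module has injective dimension $0$, so the equality reads $0=0$ when $A$ is semisimple. *)

(* Defs.v *)
From HB Require Import structures.
From mathcomp Require Import all_boot all_order all_algebra.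
From mathcomp Require Import boolp.

Set Implicit Arguments.
Unset Strict Implicit.
Unset Printing Implicit Defensive.

Import GRing.Theory.
Local Open Scope ring_scope.

(* Rings are [pzRingType]: associative, unital, possibly zero.  Left A-modules
   are [lmodType A] and right A-modules are [lmodType A^c], where [A^c] is the
   opposite ring.  The regular modules are [A^o] and [(A^c)^o], both with
   carrier A.  A left ideal is a [submod_closed] predicate on [A^o]. *)

(* Dimensions live in {0, 1, 2, ...} together with infinity, which is [None]. *)
Definition dimension := option nat.

Definition dim_le (d : dimension) (n : nat) : Prop :=
  if d is Some m then (m <= n)%N else False.

(* Least natural number satisfying P, infinity if there is none. *)
Definition least (P : nat -> Prop) : dimension :=
  if pselect (exists n, `[< P n >]) is left exP then Some (ex_minn exP)
  else None.

Section Modules.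
Variable A : pzRingType.
Implicit Types M N P Q I : lmodType A.

Definition surjective_lin M N (f : {linear M -> N}) : Prop :=
  forall y, exists x, f x = y.

(* Exactness at N of M -f-> N -g-> P. *)
Definition exact_at M N P (f : {linear M -> N}) (g : {linear N -> P}) : Prop :=
  forall y, g y = 0 <-> exists x, f x = y.

Definition injective_module I : Prop :=
  forall M N (i : {linear M -> N}) (f : {linear M -> I}), injective i ->
  exists g : {linear N -> I}, forall x, g (i x) = f x.

Definition projective_module P : Prop :=
  forall M N (p : {linear M -> N}) (f : {linear P -> N}), surjective_lin p ->
  exists g : {linear P -> M}, forall x, p (g x) = f x.

(* Injective resolutions 0 -> M -> I 0 -> I 1 -> ... *)
Record injective_resolution M := InjectiveResolution {
  ires_mod : nat -> lmodType A;
  ires_diff : forall i, {linear ires_mod i -> ires_mod i.+1};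
  ires_coaug : {linear M -> ires_mod 0%N};
  ires_injective : forall i, injective_module (ires_mod i);
  ires_coaug_inj : injective ires_coaug;
  ires_exact0 : exact_at ires_coaug (ires_diff 0%N);
  ires_exact : forall i, exact_at (ires_diff i) (ires_diff i.+1)
}.

Definition inj_dim M : dimension :=
  least (fun n => exists r : injective_resolution M,
    forall i, (n < i)%N -> forall x : ires_mod r i, x = 0).

(* Projective resolutions ... -> P 1 -> P 0 -> M -> 0 *)
Record projective_resolution M := ProjectiveResolution {
  pres_mod : nat -> lmodType A;
  pres_diff : forall i, {linear pres_mod i.+1 -> pres_mod i};
  pres_aug : {linear pres_mod 0%N -> M};
  pres_projective : forall i, projective_module (pres_mod i);
  pres_aug_surj : surjective_lin pres_aug;
  pres_exact0 : exact_at (pres_diff 0%N) pres_aug;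
  pres_exact : forall i, exact_at (pres_diff i.+1) (pres_diff i)
}.

Definition proj_dim M : dimension :=
  least (fun n => exists r : projective_resolution M,
    forall i, (n < i)%N -> forall x : pres_mod r i, x = 0).

Definition finitely_generated M : Prop :=
  exists (n : nat) (v : 'I_n -> M),
    forall x, exists a : 'I_n -> A, x = \sum_(i < n) a i *: v i.

(* The kernel of p is superfluous: N + ker p = P implies N = P. *)
Definition superfluous_kernel P M (p : {linear P -> M}) : Prop :=
  forall S : {pred P}, GRing.submod_closed S ->
  (forall x, exists y z, [/\ y \in S, p z = 0 & x = y + z]) ->
  forall x, x \in S.

Definition has_projective_cover M : Prop :=
  exists (P : lmodType A) (p : {linear P -> M}),
    [/\ projective_module P, surjective_lin p & superfluous_kernel p].

Definition noetherian_module M : Prop :=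
  forall S : nat -> {pred M}, (forall n, GRing.submod_closed (S n)) ->
  (forall n, {subset S n <= S n.+1}) ->
  exists n, forall m, (n <= m)%N -> S m =i S n.

Definition maximal_submodule M (S : {pred M}) : Prop :=
  [/\ GRing.submod_closed S, exists x, x \notin S &
      forall T : {pred M}, GRing.submod_closed T -> {subset S <= T} ->
        T =i S \/ forall x, x \in T].

End Modules.

(* The supremum of the projective dimensions of all left A-modules. *)
Definition gl_dim (A : pzRingType) : dimension :=
  least (fun n => forall M : lmodType A, dim_le (proj_dim M) n).

Definition noetherian_ring (A : pzRingType) : Prop :=
  noetherian_module (A^o : lmodType A) /\
  noetherian_module ((A^c)^o : lmodType A^c).

Definition semiperfect_ring (A : pzRingType) : Prop :=
  (forall M : lmodType A, finitely_generated M -> has_projective_cover M) /\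
  (forall M : lmodType A^c, finitely_generated M -> has_projective_cover M).

(* Intersection of the maximal left ideals. *)
Definition jacobson (A : pzRingType) : {pred A^o} := fun x =>
  `[< forall S : {pred A^o}, maximal_submodule S -> x \in S >].
Arguments jacobson : clear implicits.

(* The same subset of A, seen inside the regular right module. *)
Definition jacobson_op (A : pzRingType) : {pred (A^c)^o} :=
  fun x => (x : A^o) \in jacobson A.
Arguments jacobson_op : clear implicits.

Section JacobsonModules.
Variable A : pzRingType.

Lemma jacobson_submod : GRing.submod_closed (jacobson A).
Proof.
split=> [|a u v /asboolP uJ /asboolP vJ].
  by apply/asboolP => S [[S0 _] _ _].
apply/asboolP => S Smax; have [[_ Slin] _ _] := Smax.
by apply: Slin; [exact: uJ | exact: vJ].
Qed.

Lemma jacobson_mulr (x a : A) :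
  (x : A^o) \in jacobson A -> (x * a : A^o) \in jacobson A.
Proof.
move=> /asboolP xJ; apply/asboolP => S Smax.
have [[S0 Slin] [z zS] Smx] := Smax.
have SD u v : u \in S -> v \in S -> u + v \in S.
  by move=> uS vS; rewrite -[u]scale1r Slin.
have SZ b u : u \in S -> b *: u \in S.
  by move=> uS; rewrite -[_ *: _]addr0 Slin.
(* The left ideal (S : a) is either A or maximal. *)
pose T : {pred A^o} := fun y : A^o => (y : A) * a \in S.
have Tlin : GRing.submod_closed T.
  split=> [|b u v uT vT]; rewrite /T unfold_in; first by rewrite mul0r.
  rewrite mulrDl; apply: SD => //.
  by rewrite -mulrA; apply: (SZ b (u * a)).
have [aS|aS] := boolP (a \in S); first exact: (SZ x a).
apply: (xJ T); split=> //; first by exists 1; rewrite /T unfold_in mul1r.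
move=> U [U0 Ulin] TU.
have [UT|/existsNP[w /not_implyP[wU /negP wT]]] :=
  pselect (forall y, y \in U -> y \in T).
  by left=> y; apply/idP/idP; [exact: UT | exact: TU].
right=> y.
have UD u v : u \in U -> v \in U -> u + v \in U.
  by move=> uU vU; rewrite -[u]scale1r Ulin.
have UZ b u : u \in U -> b *: u \in U.
  by move=> uU; rewrite -[_ *: _]addr0 Ulin.
(* S + A w a is a left ideal strictly larger than S, hence all of A. *)
pose V : {pred A^o} := fun y => `[< exists2 s, s \in S &
  exists b : A, (y : A) = s + b * ((w : A) * a) >].
have Vlin : GRing.submod_closed V.
  split=> [|c u v /asboolP[s sS [b ->]] /asboolP[t tS [d ->]]].
    by apply/asboolP; exists 0 => //; exists 0; rewrite mul0r addr0.
  apply/asboolP; exists (c *: s + t); first exact: Slin.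
  exists (c * b + d); rewrite mulrDl [c *: (_ + _)]scalerDr addrACA.
  by rewrite -[c * b * _]mulrA.
have SV : {subset S <= V}.
  by move=> s sS; apply/asboolP; exists s => //; exists 0; rewrite mul0r addr0.
have waV : ((w : A) * a : A^o) \in V.
  by apply/asboolP; exists 0 => //; exists 1; rewrite mul1r add0r.
have [VS|Vfull] := Smx V Vlin SV; first by case/negP: wT; rewrite VS in waV.
have /asboolP[s sS [b yaE]] := Vfull ((y : A) * a).
have : ((y : A) - b * (w : A) : A^o) \in U.
  apply: TU; rewrite /T unfold_in mulrBl yaE -mulrA addrK; exact: sS.
by move=> /UD /(_ (UZ b _ wU)); rewrite [X in X \in U -> _]subrK.
Qed.

Lemma jacobson_op_submod : GRing.submod_closed (jacobson_op A).
Proof.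
have [J0 Jlin] := jacobson_submod; split=> // a u v uJ vJ.
have uaJ : ((u : A) * (a : A) : A^o) \in jacobson A by apply: jacobson_mulr.
by have := Jlin 1 _ _ uaJ vJ; rewrite scale1r.
Qed.

HB.instance Definition _ :=
  GRing.isSubmodClosed.Build A A^o (jacobson A) jacobson_submod.

HB.instance Definition _ :=
  GRing.isSubmodClosed.Build A^c (A^c)^o (jacobson_op A) jacobson_op_submod.

(* J as a left, respectively right, A-module. *)
Definition jacobson_lmod := {x : A^o | x \in jacobson A}.
HB.instance Definition _ := SubChoice.on jacobson_lmod.
HB.instance Definition _ := [SubChoice_isSubLmodule of jacobson_lmod by <:].

Definition jacobson_rmod := {x : (A^c)^o | x \in jacobson_op A}.
HB.instance Definition _ := SubChoice.on jacobson_rmod.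
HB.instance Definition _ := [SubChoice_isSubLmodule of jacobson_rmod by <:].

End JacobsonModules.

(* Main.v *)
(* Let E(X, N) say that Ext^1(X, N) = 0.  By dimension shifting E(K, N) is
   equivalent to E(X, C), for K an n-th syzygy of X and C an n-th cosyzygy of
   N; this links injective and projective dimensions.  Suppose that J has
   injective dimension at most n, and let K be a finitely generated n-th syzygy
   of a finitely generated module, with projective cover P and L = ker(P -> K).
   Every map P -> A sends L into J, and E(K, J) lets its restriction to L be
   extended to a map P -> J.  Subtracting, every map P -> A can be changed
   modulo J into one killing L; by a dual basis of P and Nakayama this forces
   L = 0.  So K is projective, and the global dimension is at most n.

   The left and right global dimensions agree because E(X, Y^+) and E(Y, X^+)
   are equivalent for the character modules Y^+ = Hom(Y, Q/Z): both mean that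
   Tor_1(Y, X) = 0.  Character modules also provide enough injectives. *)

Require Import Defs.
From HB Require Import structures.
From mathcomp Require Import all_boot all_order all_algebra.
From mathcomp Require Import boolp classical_sets functions.

Set Implicit Arguments.
Unset Strict Implicit.
Unset Printing Implicit Defensive.

Import GRing.Theory Num.Theory.
Local Open Scope ring_scope.

(** * Submodules, quotients and short exact sequences *)

(** Neither Ext nor Tor is constructed. E(K, N) is an extension property over projective
    presentations, and higher Ext enters only as E with iterated syzygies or cosyzygies.
    Independence of choices comes from playing a presentation of one argument against a
    copresentation of the other.

    Global dimension speaks of all modules, whereas projective covers exist for finitely generated
    ones. Baer's criterion closes this gap: if E(X, C) holds for every finitely generated X and
    every n-th cosyzygy C, all these C are injective, so E(X, C) holds for every X. The noetherian
    hypothesis keeps the n-th syzygies finitely generated.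

    The left-right comparison yields E(K, N) only for N of the form X^+, so projectivity over the
    other ring must be detected by such N alone. Projective covers allow it: with J the radical of
    that ring, the obstruction L/JL embeds in its double character module.

    Dimensions are [least] of predicates on n. Proving the predicates equivalent for each n gives
    the equalities, the infinite value included. *)

Section LinearOf.
Variables (A : pzRingType) (M N : lmodType A) (f : M -> N) (fL : linear f).
(** An alias of f indexed by a proof of linearity, from which the canonical instance is read off.
    [sub_pred] uses the same device for submodules. *)
Definition linear_of of linear f := f.
HB.instance Definition _ :=
  GRing.isLinear.Build A M N *:%R (linear_of fL) fL.
Definition mklinear : {linear M -> N} := linear_of fL.
End LinearOf.

(** The second hypothesis carries both single-valuedness (take a = 0) and linearity, so maps can be
    given by relations and choices need no separate coherence proof. *)
Lemma exists_linear (A : pzRingType) (M N : lmodType A) (P : M -> N -> Prop) :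
  (forall x, exists y, P x y) ->
  (forall a x y x' y' z, P x x' -> P y y' -> P (a *: x + y) z ->
     z = a *: x' + y') ->
  exists f : {linear M -> N}, forall x, P x (f x).
Proof.
move=> /choice[f fP] PL.
have fL : linear f by move=> a x y; apply: (PL a x y).
by exists (mklinear fL).
Qed.

Section Submodule.
Variables (A : pzRingType) (M : lmodType A) (S : {pred M}).
Hypothesis Sclosed : GRing.submod_closed S.
Definition sub_pred of GRing.submod_closed S : {pred M} := S.
HB.instance Definition _ :=
  GRing.isSubmodClosed.Build A M (sub_pred Sclosed) Sclosed.
Definition submod := {x : M | x \in sub_pred Sclosed}.
HB.instance Definition _ := SubChoice.on submod.
HB.instance Definition _ := [SubChoice_isSubLmodule of submod by <:].

Definition submod_val : {linear submod -> M} := val.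

Lemma submod_val_inj : injective submod_val. Proof. exact: val_inj. Qed.

Lemma submod_valP (x : submod) : submod_val x \in S. Proof. exact: (valP x). Qed.

Lemma submod_in x : x \in S -> exists y, submod_val y = x.
Proof. by move=> xS; exists (Sub x xS : submod); exact: SubK. Qed.

Lemma corestrict (N : lmodType A) (f : {linear N -> M}) :
  (forall x, f x \in S) ->
  exists g : {linear N -> submod}, forall x, submod_val (g x) = f x.
Proof.
move=> fS.
apply: (@exists_linear _ _ _ (fun x y => submod_val y = f x)) => [x|].
  by have [y] := submod_in (fS x); exists y.
move=> a x y x' y' z ex ey ez; apply: submod_val_inj.
by rewrite ez !linearP ex ey.
Qed.
End Submodule.

Section Closed.
Variables (A : pzRingType) (M : lmodType A) (S : {pred M}).
Hypothesis Sclosed : GRing.submod_closed S.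
Lemma closed0 : 0 \in S. Proof. by case: Sclosed. Qed.
Lemma closedD x y : x \in S -> y \in S -> x + y \in S.
Proof. by case: Sclosed => _ SL xS yS; rewrite -[x]scale1r SL. Qed.
Lemma closedZ a x : x \in S -> a *: x \in S.
Proof. by case: Sclosed => S0 SL xS; rewrite -[_ *: _]addr0 SL. Qed.
Lemma closedN x : x \in S -> - x \in S.
Proof. by rewrite -scaleN1r; exact: closedZ. Qed.
Lemma closedB x y : x \in S -> y \in S -> x - y \in S.
Proof. by move=> xS yS; rewrite closedD ?closedN. Qed.
Lemma closed_sum I (r : seq I) (F : I -> M) :
  (forall i, F i \in S) -> \sum_(i <- r) F i \in S.
Proof.
by move=> FS; elim/big_rec: _ => [|i x _ xS]; [exact: closed0|exact: closedD].
Qed.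
End Closed.

Section Quotient.
Variables (A : pzRingType) (M : lmodType A) (S : {pred M}).
Hypothesis Sclosed : GRing.submod_closed S.

(** On a nonempty predicate [choose] depends on the predicate alone, so congruent elements get the
    same representative. The quotient can thus be the subtype of chosen representatives. *)
Definition coset_repr (x : M) : M := choose (fun y => x - y \in S) x.

Fact coset_reprP x : x - coset_repr x \in S.
Proof. by apply: (chooseP (P := fun y => x - y \in S)); rewrite subrr closed0. Qed.

Fact coset_repr_eq x y : x - y \in S -> coset_repr x = coset_repr y.
Proof.
move=> xy; rewrite /coset_repr.
have E : (fun z => x - z \in S) =1 (fun z => y - z \in S).
  move=> z; apply/idP/idP => h.
    by rewrite -[y - z](subrKA x) closedD // -opprB closedN.
  by rewrite -[x - z](subrKA y) closedD.
by rewrite (eq_choose E); apply: choose_id => //=;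
  rewrite ?subrr ?closed0 // -opprB closedN.
Qed.

Fact coset_repr_id x : coset_repr (coset_repr x) == coset_repr x.
Proof. by apply/eqP/coset_repr_eq; rewrite -opprB closedN // coset_reprP. Qed.

Definition quot of GRing.submod_closed S := {x : M | coset_repr x == x}.
Local Notation Q := (quot Sclosed).
HB.instance Definition _ := Choice.on Q.
Definition quot_pi (x : M) : Q := exist _ (coset_repr x) (coset_repr_id x).
Definition quot_val (x : Q) : M := val x.

Lemma quot_valK x : quot_pi (quot_val x) = x.
Proof. by apply: val_inj => /=; apply/eqP; exact: (valP x). Qed.

Lemma quot_eq x y : quot_pi x = quot_pi y <-> x - y \in S.
Proof.
split=> [[e]|xy]; last by apply: val_inj; exact: coset_repr_eq.
rewrite -(subrKA (coset_repr x)) closedD // ?coset_reprP //.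
by rewrite e -opprB closedN ?coset_reprP.
Qed.

Lemma quot_val_pi x : quot_val (quot_pi x) - x \in S.
Proof. by apply/quot_eq; rewrite quot_valK. Qed.

Let add (x y : Q) := quot_pi (quot_val x + quot_val y).
Let opp (x : Q) := quot_pi (- quot_val x).
Let scale a (x : Q) := quot_pi (a *: quot_val x).

Let addE x y : add (quot_pi x) (quot_pi y) = quot_pi (x + y).
Proof. by apply/quot_eq; rewrite opprD addrACA closedD // quot_val_pi. Qed.
Let oppE x : opp (quot_pi x) = quot_pi (- x).
Proof. by apply/quot_eq; rewrite -opprD closedN // quot_val_pi. Qed.
Let scaleE a x : scale a (quot_pi x) = quot_pi (a *: x).
Proof. by apply/quot_eq; rewrite -scalerBr closedZ // quot_val_pi. Qed.

Let addA : associative add.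
Proof.
by move=> x y z; rewrite -(quot_valK x) -(quot_valK y) -(quot_valK z) !addE addrA.
Qed.
Let addC : commutative add.
Proof. by move=> x y; rewrite -(quot_valK x) -(quot_valK y) !addE addrC. Qed.
Let add0 : left_id (quot_pi 0) add.
Proof. by move=> x; rewrite -(quot_valK x) !addE add0r. Qed.
Let addN : left_inverse (quot_pi 0) opp add.
Proof. by move=> x; rewrite -(quot_valK x) oppE addE addNr. Qed.
HB.instance Definition _ := GRing.isZmodule.Build Q addA addC add0 addN.

Let piD (x y : M) : quot_pi x + quot_pi y = quot_pi (x + y).
Proof. exact: addE. Qed.

Let scaleA a b x : scale a (scale b x) = scale (a * b) x.
Proof. by rewrite -(quot_valK x) !scaleE scalerA. Qed.
Let scale1 : left_id 1 scale.
Proof. by move=> x; rewrite -(quot_valK x) !scaleE scale1r. Qed.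
Let scaleDr : right_distributive scale +%R.
Proof.
by move=> a x y; rewrite -(quot_valK x) -(quot_valK y) piD !scaleE piD scalerDr.
Qed.
Let scaleDl x : {morph scale^~ x : a b / a + b}.
Proof. by move=> a b; rewrite -(quot_valK x) !scaleE piD scalerDl. Qed.
HB.instance Definition _ :=
  GRing.Zmodule_isLmodule.Build A Q scaleA scale1 scaleDr scaleDl.

Fact quot_pi_linear : linear quot_pi.
Proof.
by move=> a x y; rewrite -piD -scaleE.
Qed.

Definition quot_proj : {linear M -> Q} := mklinear quot_pi_linear.

Lemma quot_proj_surj : surjective_lin quot_proj.
Proof. by move=> x; exists (quot_val x); exact: quot_valK. Qed.

Lemma quot_proj_eq0 x : quot_proj x = 0 <-> x \in S.
Proof. by rewrite -(linear0 quot_proj) quot_eq subr0. Qed.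
End Quotient.

Section Exactness.
Variable A : pzRingType.
Implicit Types K L M N P Q X I C : lmodType A.

Definition short_exact K P X (i : {linear K -> P}) (p : {linear P -> X}) :=
  [/\ injective i, surjective_lin p & exact_at i p].

Lemma linear_inj M N (f : {linear M -> N}) :
  (forall x, f x = 0 -> x = 0) -> injective f.
Proof.
move=> f0 x y e; apply/eqP; rewrite -subr_eq0; apply/eqP/f0.
by rewrite linearB e subrr.
Qed.

Lemma inj_eq0 M N (f : {linear M -> N}) x : injective f -> f x = 0 -> x = 0.
Proof. by move=> fI fx; apply: fI; rewrite fx linear0. Qed.

Definition ker_pred M N (f : {linear M -> N}) : {pred M} := fun x => f x == 0.

Lemma ker_closed M N (f : {linear M -> N}) : GRing.submod_closed (ker_pred f).
Proof.
split=> [|a x y]; rewrite !unfold_in /ker_pred ?linear0 // => /eqP fx /eqP fy.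
by rewrite linearP fx fy scaler0 addr0.
Qed.

Lemma ker_predP M N (f : {linear M -> N}) x : x \in ker_pred f <-> f x = 0.
Proof. by rewrite unfold_in; split=> /eqP. Qed.

Definition im_pred M N (f : {linear M -> N}) : {pred N} :=
  fun y => `[< exists x, f x = y >].

Lemma im_closed M N (f : {linear M -> N}) : GRing.submod_closed (im_pred f).
Proof.
split=> [|a _ _ /asboolP[x <-] /asboolP[y <-]]; apply/asboolP.
  by exists 0; rewrite linear0.
by exists (a *: x + y); rewrite linearP.
Qed.

Lemma ker_short_exact M N (f : {linear M -> N}) :
  surjective_lin f -> short_exact (submod_val (ker_closed f)) f.
Proof.
move=> fS; split=> //.
move=> y; split=> [fy|[x <-]].
  by apply: submod_in; apply/ker_predP.
by apply/ker_predP; exact: submod_valP.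
Qed.

Lemma coker_short_exact M N (f : {linear M -> N}) :
  injective f -> short_exact f (quot_proj (im_closed f)).
Proof.
move=> fI; split=> //; first exact: quot_proj_surj.
by move=> y; rewrite quot_proj_eq0; split=> [/asboolP|?]; last exact/asboolP.
Qed.

Lemma quot_short_exact M (S : {pred M}) (Sc : GRing.submod_closed S) :
  short_exact (submod_val Sc) (quot_proj Sc).
Proof.
split; [exact: submod_val_inj|exact: quot_proj_surj|move=> y].
rewrite quot_proj_eq0; split=> [yS|[x <-]]; first exact: submod_in.
exact: submod_valP.
Qed.

Lemma factor_surj Q K X (q : {linear Q -> K}) (u : {linear Q -> X}) :
  surjective_lin q -> (forall x, q x = 0 -> u x = 0) ->
  exists w : {linear K -> X}, forall x, w (q x) = u x.
Proof.
move=> qS qu.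
have uE x y : q x = q y -> u x = u y.
  move=> e; apply/eqP; rewrite -subr_eq0 -linearB; apply/eqP/qu.
  by rewrite linearB e subrr.
have [w wP] : exists w : {linear K -> X},
    forall y, exists2 x, q x = y & w y = u x.
  apply: (@exists_linear _ _ _ (fun y z => exists2 x, q x = y & z = u x)).
    by move=> y; have [x <-] := qS y; exists (u x), x.
  move=> a _ _ _ _ z [x <- ->] [y <- ->] [t et ->].
  by rewrite -linearP; apply: uE; rewrite linearP.
by exists w => x; have [y /uE <-] := wP (q x).
Qed.

Lemma factor_inj N I X (i : {linear N -> I}) (u : {linear X -> I}) :
  injective i -> (forall x, exists y, i y = u x) ->
  exists w : {linear X -> N}, forall x, i (w x) = u x.
Proof.
move=> iI iu; apply: (@exists_linear _ _ _ (fun x y => i y = u x)) => //.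
move=> a x y x' y' z ex ey ez.
by apply: iI; rewrite ez !linearP ex ey.
Qed.

Lemma linear_inverse M N (f : {linear M -> N}) :
  injective f -> surjective_lin f ->
  exists g : {linear N -> M}, cancel f g /\ cancel g f.
Proof.
move=> fI fS; have [g gP] := @factor_inj _ _ _ f idfun fI fS.
by exists g; split=> // x; apply: fI; rewrite gP.
Qed.

Lemma injective_module_iso M N (f : {linear M -> N}) :
  injective f -> surjective_lin f -> injective_module N -> injective_module M.
Proof.
move=> fI fS NI U V i h iI; have [g [fK gK]] := linear_inverse fI fS.
have [k kP] := NI U V i (f \o h) iI.
by exists (g \o k) => x /=; rewrite kP /= fK.
Qed.

Lemma projective_module_iso M N (f : {linear M -> N}) :
  injective f -> surjective_lin f -> projective_module M -> projective_module N.
Proof.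
move=> fI fS MP U V p h pS; have [g [fK gK]] := linear_inverse fI fS.
have [k kP] := MP U V p (h \o f) pS.
by exists (k \o g) => x /=; rewrite kP /= gK.
Qed.

(** * Vanishing of Ext *)

(** For Q projective, Ext^1(K, N) is the cokernel of Hom(Q, N) -> Hom(L, N), hence the extension
    property. It is demanded of all presentations; [ext1_vanish_extend] reduces it to one. *)
Definition ext1_vanish K N : Prop :=
  forall L Q (l : {linear L -> Q}) (q : {linear Q -> K}),
  short_exact l q -> projective_module Q -> forall f : {linear L -> N},
  exists g : {linear Q -> N}, forall x, g (l x) = f x.

(* Both conditions say that Ext^1(K, N) = 0, computed from a projective
   presentation of K and from an injective copresentation of N. *)
Lemma ext1_balanced L Q K N I C (l : {linear L -> Q}) (q : {linear Q -> K})
    (i : {linear N -> I}) (c : {linear I -> C}) :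
  short_exact l q -> short_exact i c ->
  projective_module Q -> injective_module I ->
  (forall f : {linear L -> N},
     exists g : {linear Q -> N}, forall x, g (l x) = f x) <->
  (forall h : {linear K -> C},
     exists u : {linear K -> I}, forall x, c (u x) = h x).
Proof.
move=> [lI qS lq] [iI cS ic] QP II; split=> [ext h|lift f].
  (* The lift [u0] of h q sends L into N. Subtracting an extension to Q of this restriction gives a
     map that kills L and descends to K. *)
  have [u0 u0P] := QP _ _ c (h \o q) cS.
  have [f fP] : exists f : {linear L -> N}, forall x, i (f x) = (u0 \o l) x.
    apply: factor_inj => // x; apply/ic; rewrite u0P /=.
    by rewrite (iffRL (lq _)) ?linear0 //; exists x.
  have [g gP] := ext f.
  have [w wP] : exists w : {linear K -> I}, forall x, w (q x) = (u0 \- (i \o g)) x.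
    apply: factor_surj => // x /lq[y <-] /=.
    by rewrite gP fP /= subrr.
  exists w => x; have [y <-] := qS x.
  rewrite wP /= linearB u0P /= (iffRL (ic (i (g y)))) ?subr0 //.
  by exists (g y).
(* Dually, c u descends to K. Subtracting from u a lift of the descended map gives a map Q -> I with
   values in N. *)
have [u uP] := II _ _ l (i \o f) lI.
have [h hP] : exists h : {linear K -> C}, forall x, h (q x) = (c \o u) x.
  apply: factor_surj => // x /lq[y <-] /=; rewrite uP /=.
  by apply/ic; exists (f y).
have [w wP] := lift h.
have [g gP] : exists g : {linear Q -> N}, forall x, i (g x) = (u \- (w \o q)) x.
  apply: factor_inj => // x; apply/ic => /=.
  by rewrite linearB wP hP /= subrr.
exists g => x; apply: iI; rewrite gP /= uP /=.
have -> : q (l x) = 0 by apply/lq; exists x.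
by rewrite linear0 subr0.
Qed.
End Exactness.

(** * Baer's criterion *)

Section Baer.
Variable A : pzRingType.

(** Partial extensions of f along i, kept as graphs so that they are ordered by plain inclusion of
    sets. The first clause is single-valuedness. *)
Let linear_graph (M N I : lmodType A) (i : {linear M -> N}) (f : {linear M -> I})
    (G : set (N * I)) :=
  [/\ forall y, G (0, y) -> y = 0,
      forall a n y n' y', G (n, y) -> G (n', y') ->
        G (a *: n + n', a *: y + y') &
      forall m, G (i m, f m)].

Lemma linear_graph_maximal (M N I : lmodType A) (i : {linear M -> N})
    (f : {linear M -> I}) : injective i ->
  exists2 G, linear_graph i f G &
    forall H, linear_graph i f H -> (G `<=` H)%classic -> H = G.
Proof.
move=> iI; pose G0 : set (N * I) := fun p => exists m, p = (i m, f m).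
have G0good : linear_graph i f G0.
  split=> [y [m [e ->]]|a n y n' y' [m [-> ->]] [m' [-> ->]]|m]; last by exists m.
  - by rewrite (inj_eq0 iI (esym e)) linear0.
  - by exists (a *: m + m'); rewrite !linearP.
(* [Zorn_bigcup] also asks about the empty chain, whose union is empty; adjoining [G0] makes that
   case admissible. *)
pose P G := linear_graph i f (G `|` G0)%classic.
have [F FP Ftot|G [PG Gmax]] := @Zorn_bigcup _ P.
  pose U := (\bigcup_(X in F) X)%classic.
  have lift p q : (U `|` G0)%classic p -> (U `|` G0)%classic q ->
      exists X, [/\ linear_graph i f (X `|` G0)%classic,
        (X `<=` U)%classic, (X `|` G0)%classic p & (X `|` G0)%classic q].
    have one X : F X -> linear_graph i f (X `|` G0)%classic /\ (X `<=` U)%classic.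
      by move=> FX; split; [exact: FP|move=> z Xz; exists X].
    move=> [[X FX Xp]|G0p] [[Y FY Yq]|G0q].
    - have [XY|YX] := Ftot _ _ FX FY.
        by have [? ?] := one Y FY; exists Y; split=> //; left=> //; exact: XY.
      by have [? ?] := one X FX; exists X; split=> //; left=> //; exact: YX.
    - by have [? ?] := one X FX; exists X; split=> //; [left|right].
    - by have [? ?] := one Y FY; exists Y; split=> //; [right|left].
    - exists set0; rewrite set0U; split=> //.
  split=> [y h|a n y n' y' h h'|m]; last by right; exists m.
    by have [X [[X0 _ _] _ Xy _]] := lift _ _ h h; exact: X0.
  have [X [[_ XL _] XU Xn Xn']] := lift _ _ h h'.
  by have [Xs|?] := XL a _ _ _ _ Xn Xn'; [left; exact: XU|right].
exists (G `|` G0)%classic => // H Hgood GH.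
have HG0 : (H `|` G0)%classic = H.
  by apply/setUidPl => _ [m ->]; case: Hgood.
apply/seteqP; split=> // z Hz; apply: contrapT => nz.
have PH : P H by rewrite /P HG0.
apply: (Gmax H _ PH); split; first by move=> w Gw; apply: GH; left.
by move=> HG; apply: nz; left; exact: HG.
Qed.

(** For a maximal partial extension G and n in N, the values of G at the multiples a n define a map
    on the left ideal of the admissible a. The element e representing it is a consistent value at n,
    and by maximality (n, e) already lies in G. *)
Lemma baer_criterion (I : lmodType A) :
  (forall (S : {pred A^o}) (Sc : GRing.submod_closed S)
     (phi : {linear submod Sc -> I}),
     exists e, forall s, phi s = (submod_val Sc s : A) *: e) ->
  injective_module I.
Proof.
move=> ext M N i f iI; have [G [G0 GL Gif] Gmax] := linear_graph_maximal f iI.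
have GN n y n' y' : G (n, y) -> G (n', y') -> G (n - n', y - y').
  by move=> /[swap] h /(GL (-1) _ _ _ _ h); rewrite !scaleN1r ![- _ + _]addrC.
have GE n y y' : G (n, y) -> G (n, y') -> y = y'.
  by move=> h /(GN _ _ _ _ h); rewrite subrr => /G0/eqP; rewrite subr_eq0 => /eqP.
have G00 : G (0, 0) by rewrite -(linear0 i) -(linear0 f).
suff Gtot n : exists y, G (n, y).
  have [g gP] : exists g : {linear N -> I}, forall n, G (n, g n).
    apply: (@exists_linear _ _ _ (fun n y => G (n, y))) => // a n n' y y' z h h'.
    by move=> /GE; apply; exact: GL.
  by exists g => x; apply: GE (Gif x).
pose S : {pred A^o} := fun a : A => `[< exists y, G (a *: n, y) >].
have Sc : GRing.submod_closed S.
  split=> [|a u v /asboolP[y yP] /asboolP[y' yP']]; apply/asboolP.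
    by exists 0; rewrite scale0r.
  by exists (a *: y + y'); rewrite scalerDl -scalerA; exact: GL.
have [phi phiP] : exists phi : {linear submod Sc -> I},
    forall s, G ((submod_val Sc s : A) *: n, phi s).
  apply: (@exists_linear _ _ _ (fun s y => G ((submod_val Sc s : A) *: n, y))).
    by move=> s; have /asboolP := submod_valP s.
  move=> a s t y y' z h h' /GE; apply; rewrite linearP scalerDl.
  have -> : (a *: submod_val Sc s : A) *: n = a *: ((submod_val Sc s : A) *: n).
    by rewrite scalerA.
  exact: GL.
have [e eP] := ext S Sc phi.
have eG a y : G (a *: n, y) -> y = a *: e.
  move=> h; have aS : (a : A^o) \in S by apply/asboolP; exists y.
  by have [s sa] := submod_in Sc aS; move: (phiP s); rewrite eP sa => /(GE _ _ _ h).
pose H : set (N * I) := fun p => exists m y a, G (m, y) /\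
  p = (m + a *: n, y + a *: e).
have HE : H = G.
  apply: Gmax; last first.
    by move=> [m y] h; exists m, y, 0; rewrite !scale0r !addr0.
  split=> [y [m [y' [a [h [e0 ->]]]]]|a ? ? ? ?|m].
  - have h1 : G (a *: n, - y').
      have := GN _ _ _ _ G00 h; rewrite !sub0r.
      by rewrite -(eqP (_ : a *: n == - m)) // -addr_eq0 addrC -e0.
    by rewrite -(eG _ _ h1) subrr.
  - move=> [m [y [b [h [-> ->]]]]] [m' [y' [b' [h' [-> ->]]]]].
    exists (a *: m + m'), (a *: y + y'), (a * b + b'); split; first exact: GL.
    by congr (_, _); rewrite scalerDr scalerDl !scalerA addrACA.
  - by exists (i m), (f m), 0; rewrite !scale0r !addr0.
by exists e; rewrite -HE; exists 0, 0, 1; rewrite !scale1r !add0r.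
Qed.
End Baer.

(** * Free modules *)

Section Free.
Variables (A : pzRingType) (T : choiceType).

Definition finite_support : {pred T -> A^o} :=
  fun x => `[< exists s : seq T, forall t, t \notin s -> x t = 0 >].

Lemma finite_support_closed : GRing.submod_closed finite_support.
Proof.
split=> [|a x y /asboolP[s sx] /asboolP[s' sy]]; apply/asboolP; first by exists [::].
exists (s ++ s') => t; rewrite mem_cat => /norP[ts ts'].
by rewrite /GRing.add /GRing.scale /= sx ?sy // scaler0 addr0.
Qed.

(** The basis T may be infinite, so that a module can index its own free cover. *)
Definition free_module : lmodType A := submod finite_support_closed.
Definition coef (x : free_module) (t : T) : A := submod_val _ x t.

Lemma coef_inj x y : coef x =1 coef y -> x = y.
Proof. by move=> e; apply: submod_val_inj; apply: funext. Qed.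

Lemma coefP a x y t : coef (a *: x + y) t = a * coef x t + coef y t.
Proof. by rewrite /coef linearP. Qed.

Lemma coef_sum I (r : seq I) (F : I -> free_module) t :
  coef (\sum_(i <- r) F i) t = \sum_(i <- r) coef (F i) t.
Proof. by rewrite /coef linear_sum fct_sumE. Qed.

Lemma coef_support x : exists2 s : seq T, uniq s & forall t, t \notin s -> coef x t = 0.
Proof.
have /asboolP[s sx] := submod_valP x; exists (undup s); first exact: undup_uniq.
by move=> t; rewrite mem_undup; exact: sx.
Qed.

Fact delta_support (t : T) : (fun u => (u == t)%:R : A^o) \in finite_support.
Proof.
by apply/asboolP; exists [:: t] => u; rewrite inE => /negPf ->.
Qed.

Definition delta t : free_module :=
  exist (fun x => x \in sub_pred finite_support_closed) _ (delta_support t).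

Lemma coef_delta t u : coef (delta t) u = (u == t)%:R.
Proof. by []. Qed.

Lemma free_expand x s : uniq s -> (forall t, t \notin s -> coef x t = 0) ->
  x = \sum_(t <- s) coef x t *: delta t.
Proof.
move=> us sx; apply: coef_inj => u; rewrite coef_sum.
have E t : coef (coef x t *: delta t) u = if t == u then coef x u else 0.
  rewrite -[_ *: _]addr0 coefP coef_delta /coef linear0 addr0 eq_sym.
  by case: eqP => [->|_]; rewrite ?mulr1 ?mulr0.
rewrite (eq_bigr _ (fun t _ => E t)) -big_mkcond /=.
have [us'|us'] := boolP (u \in s); last by rewrite sx // big1.
rewrite -big_filter filter_pred1_uniq // big_seq1; exact: erefl.
Qed.

Lemma free_lift (M : lmodType A) (phi : T -> M) :
  exists g : {linear free_module -> M}, forall t, g (delta t) = phi t.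
Proof.
(* Any duplicate-free list containing the support may be used. [widen] shows that the value does not
   depend on it, so the lists for x, y and a x + y can be compared on their union. *)
pose P (x : free_module) y := exists s : seq T,
  [/\ uniq s, forall t, t \notin s -> coef x t = 0 &
      y = \sum_(t <- s) coef x t *: phi t].
have widen x (s r : seq T) : uniq s -> uniq r -> {subset s <= r} ->
    (forall t, t \notin s -> coef x t = 0) ->
    \sum_(t <- s) coef x t *: phi t = \sum_(t <- r) coef x t *: phi t.
  move=> us ur sr sx; rewrite [RHS](bigID (mem s)) /= [X in _ + X]big1 ?addr0.
    rewrite -[RHS]big_filter; apply: perm_big; apply: uniq_perm => //.
      exact: filter_uniq.
    by move=> t; rewrite mem_filter; case ts: (t \in s) => //=; rewrite sr.
  by move=> t /sx ->; rewrite scale0r.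
have [g gP] : exists g : {linear free_module -> M}, forall x, P x (g x).
  apply: exists_linear => [x|a x y _ _ _ [s [us sx ->]] [r [ur ry ->]] [q [uq qz ->]]].
    by have [s us sx] := coef_support x; exists (\sum_(t <- s) coef x t *: phi t), s.
  pose w := undup (s ++ r ++ q).
  have uw : uniq w by exact: undup_uniq.
  rewrite (widen x s w) ?(widen y r w) ?(widen _ q w) //; last first.
  - by move=> t ts; rewrite mem_undup !mem_cat ts.
  - by move=> t ts; rewrite mem_undup !mem_cat ts orbT.
  - by move=> t ts; rewrite mem_undup !mem_cat ts !orbT.
  rewrite scaler_sumr -big_split /=; apply: eq_bigr => t _.
  by rewrite coefP scalerDl scalerA.
exists g => t; have [s [us st ->]] := gP (delta t).
rewrite (widen _ s (undup (t :: s))) ?undup_uniq //; last first.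
  by move=> u us'; rewrite mem_undup inE us' orbT.
rewrite (bigD1_seq t) ?undup_uniq ?mem_undup ?inE ?eqxx //= coef_delta eqxx scale1r.
by rewrite big1 ?addr0 // => u /negPf ut; rewrite coef_delta ut scale0r.
Qed.

Lemma free_projective : projective_module free_module.
Proof.
move=> M N p f pS; have [phi phiP] := choice (fun t => pS (f (delta t))).
have [g gP] := free_lift phi; exists g => x.
have [s us sx] := coef_support x; rewrite (free_expand us sx) !linear_sum.
by apply: eq_bigr => t _; rewrite !linearZ /= gP phiP.
Qed.
End Free.

(** * Free covers, and projectivity and injectivity tested by Ext *)

Section EnoughProjectives.
Variable A : pzRingType.
Implicit Types M N : lmodType A.

Lemma exists_free_cover M :
  exists g : {linear free_module A M -> M}, forall x, g (delta A x) = x.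
Proof. exact: free_lift. Qed.

Definition free_cover M : {linear free_module A M -> M} :=
  projT1 (cid (exists_free_cover M)).

Lemma free_cover_surj M : surjective_lin (free_cover M).
Proof. by move=> x; exists (delta A x); rewrite /free_cover; case: cid. Qed.

Definition syzygy M : lmodType A := submod (ker_closed (free_cover M)).

Lemma syzygy_short_exact M :
  short_exact (submod_val (ker_closed (free_cover M))) (free_cover M).
Proof. exact: ker_short_exact (@free_cover_surj M). Qed.

Lemma projective_retract M N (s : {linear M -> N}) (r : {linear N -> M}) :
  cancel s r -> projective_module N -> projective_module M.
Proof.
move=> sK NP U V p f pS; have [g gP] := NP U V p (f \o r) pS.
by exists (g \o s) => x /=; rewrite gP /= sK.
Qed.

Lemma projective_section M N (p : {linear N -> M}) :
  projective_module M -> surjective_lin p -> exists s : {linear M -> N}, cancel s p.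
Proof. by move=> MP pS; have [s sP] := MP _ _ p idfun pS; exists s. Qed.

Lemma regular_projective : projective_module (A^o : lmodType A).
Proof.
move=> M N p f pS; have [x px] := pS (f 1).
have gL : linear (fun a : A^o => (a : A) *: x).
  by move=> a b c; rewrite scalerDl scalerA.
exists (mklinear gL) => a; rewrite linearZ /= px -linearZ /=.
by congr (f _); exact: mulr1.
Qed.

(** A left ideal S has the presentation S -> A -> A/S with A projective and A/S cyclic. The element
    required by Baer's criterion is the image of 1 under the extended map. *)
Lemma injective_of_ext1_vanish (I : lmodType A) :
  (forall X : lmodType A, finitely_generated X -> ext1_vanish X I) ->
  injective_module I.
Proof.
move=> ext; apply: baer_criterion => S Sc phi.
have fgQ : finitely_generated (quot Sc : lmodType A).
  exists 1%N, (fun=> quot_proj Sc (1 : A)) => x; have [a <-] := quot_proj_surj x.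
  exists (fun=> a); rewrite big_ord1 -linearZ /=; congr (quot_pi _ _).
  by rewrite -[LHS]mulr1.
have [g gP] := ext _ fgQ _ _ _ _ (quot_short_exact Sc) regular_projective phi.
exists (g (1 : A)) => s; rewrite -gP -linearZ /=; congr (g _).
by rewrite -[LHS]mulr1.
Qed.

(** Extending the identity of the syzygy splits the free presentation, making M a retract of a free
    module. *)
Lemma projective_of_ext1_vanish M :
  (forall N, ext1_vanish M N) -> projective_module M.
Proof.
move=> ext; have [vI vS vE] := syzygy_short_exact M.
have [g gP] := ext _ _ _ _ _ (syzygy_short_exact M) (@free_projective A M) idfun.
pose v : {linear syzygy M -> free_module A M} := submod_val _.
have [s sP] : exists s : {linear M -> free_module A M},
    forall x, s (free_cover M x) = (idfun \- (v \o g)) x.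
  apply: factor_surj => // x /vE[y <-] /=.
  by rewrite gP subrr.
apply: (@projective_retract _ _ s (free_cover M)); last exact: free_projective.
move=> x; have [y <-] := free_cover_surj x.
rewrite sP /= linearB; have -> : free_cover M (v (g y)) = 0 by apply/vE; exists (g y).
by rewrite subr0.
Qed.

Lemma ext1_vanish_projective M N : projective_module M -> ext1_vanish M N.
Proof.
move=> MP L Q l q [lI qS lq] QP f.
have [s sK] := projective_section MP qS.
have [r rP] : exists r : {linear Q -> L}, forall x, l (r x) = (idfun \- (s \o q)) x.
  by apply: factor_inj => // x; apply/lq; rewrite /= linearB sK subrr.
exists (f \o r) => x /=; congr (f _); apply: lI; rewrite rP /=.
have -> : q (l x) = 0 by apply/lq; exists x.
by rewrite linear0 subr0.
Qed.

Lemma ext1_vanish_injective M N : injective_module N -> ext1_vanish M N.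
Proof. by move=> NI L Q l q [lI _ _] _ f; exact: NI. Qed.
End EnoughProjectives.

(** * The injective cogenerator Q/Z *)

Lemma int_submod_principal (S : {pred int^o}) : GRing.submod_closed S ->
  exists2 d : nat, (d%:Z : int^o) \in S &
    forall a : int, (a : int^o) \in S -> (d %| `|a|)%N.
Proof.
move=> Sc; have SN (a : int) : (a : int^o) \in S -> (`|a|%N%:Z : int^o) \in S.
  by case: (intP a) => // n; rewrite abszN; exact: (closedN Sc).
have [[n nS]|nope] :=
  pselect (exists n : nat, (0 < n)%N && ((n%:Z : int^o) \in S)); last first.
  (* Without positive elements S is zero, and 0 divides only 0. *)
  exists 0%N => [|a /SN aS]; first exact: (closed0 Sc).
  rewrite dvd0n; apply: contrapT => /negP a0; apply: nope.
  by exists `|a|%N; rewrite lt0n a0.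
have exS : exists n : nat, (0 < n)%N && ((n%:Z : int^o) \in S) by exists n.
have [d /andP[d0 dS] dmin] := ex_minnP exS.
exists d => // a /SN; move: `|a|%N => {a} a aS.
have rS : ((a %% d)%N%:Z : int^o) \in S.
  have -> : (a %% d)%N%:Z = a%:Z - (a %/ d)%N%:Z * d%:Z.
    by rewrite {2}(divn_eq a d) PoszD PoszM addrC addKr.
  by apply: (closedB Sc aS); exact: (closedZ Sc (a %/ d)%N%:Z dS).
rewrite /dvdn -leqn0 leqNgt; apply/negP => r0.
by have := dmin (a %% d)%N; rewrite r0 rS leqNgt ltn_mod d0 => /(_ isT).
Qed.

Definition integral : {pred zmodule rat} := fun x : rat => x \is a Num.int.
Lemma integral_closed : GRing.submod_closed integral.
Proof.
split=> [|a x y]; rewrite !unfold_in /integral ?rpred0 // => xZ yZ.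
by change ((x : rat) *~ a + (y : rat) \is a Num.int); rewrite rpredD // rpredMz.
Qed.

Definition QZ : lmodType int := quot integral_closed.
Definition QZpi (x : rat) : QZ := quot_proj integral_closed x.
Lemma QZpiZ (a : int) (x : rat) : a *: QZpi x = QZpi (a%:~R * x).
Proof. by rewrite /QZpi -linearZ /= scalezrE -mulrzl. Qed.

Lemma QZpi_eq0 x : QZpi x = 0 <-> x \is a Num.int.
Proof. exact: quot_proj_eq0. Qed.

Lemma QZ_injective : injective_module QZ.
Proof.
apply: baer_criterion => S Sc phi.
have [d dS Sd] := int_submod_principal Sc; have [d' ed'] := submod_in Sc dS.
have [q qd] := quot_proj_surj (phi d').
(* Divisibility of Q/Z: a representative q of the value at the generator d is divided by d. For d =
   0 the ideal is zero and both sides vanish. *)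
exists (QZpi (q / d%:R)) => s.
have /dvdnP[k sk] := Sd _ (submod_valP s).
pose c : int := (-1) ^+ ((submod_val Sc s : int) < 0)%R * k%:Z.
have sc : (submod_val Sc s : int) = c * d%:Z.
  by rewrite [LHS]intEsign sk PoszM mulrA.
have -> : s = c *: d' by apply: submod_val_inj; rewrite linearZ_LR ed'.
rewrite !linearZ_LR ed' -qd -/(QZpi q) QZpiZ.
change ((c *: (d%:Z : int^o) : int) *: QZpi (q / d%:R))
  with ((c * d%:Z) *: QZpi (q / d%:R)).
rewrite QZpiZ.
have [d0|d0] := eqVneq d 0%N; last first.
  suff -> : (c * d%:Z)%:~R * (q / d%:R) = c%:~R * q :> rat by [].
  rewrite intrM -mulrA; congr (_ * _).
  by rewrite -[(d%:Z)%:~R]/(d%:R) mulrC divfK // pnatr_eq0.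
have d'0 : d' = 0 by apply: submod_val_inj; rewrite ed' d0 linear0.
have qZ : q \is a Num.int by apply/QZpi_eq0; rewrite /QZpi qd d'0 linear0.
transitivity (0 : QZ); first by apply/QZpi_eq0; rewrite rpredM // rpred_int.
by apply/esym/QZpi_eq0; rewrite d0 mulr0 mul0r rpred0.
Qed.

Lemma QZ_cogenerator (M : lmodType int) (x : M) : x != 0 ->
  exists f : {linear M -> QZ}, f x != 0.
Proof.
move=> x0; pose S : {pred int^o} := fun a : int => a *: x == 0.
have Sc : GRing.submod_closed S.
  split=> [|a u v]; rewrite !unfold_in /S ?scale0r // => /eqP u0 /eqP v0.
  by rewrite scalerDl -scalerA u0 v0 scaler0 addr0.
(* Here n is the order of x, or 2 if that order is infinite. Sending x to 1/n is then well defined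
   on the subgroup generated by x, nonzero because n > 1, and extends by injectivity of Q/Z. *)
have [n n1 Sn] : exists2 n : nat, (1 < n)%N &
    forall a : int, a *: x = 0 -> (n %| `|a|)%N.
  have [d dS Sd] := int_submod_principal Sc.
  have {}Sd a : a *: x = 0 -> (d %| `|a|)%N by move=> e; apply: Sd; apply/eqP.
  have [d1|d1|d1] := ltngtP d 1%N.
  - exists 2%N => // a /Sd; move: d1; rewrite ltnS leqn0 => /eqP ->.
    by rewrite dvd0n => /eqP ->.
  - by exists d.
  - by move: dS; rewrite d1 unfold_in /S scale1r (negPf x0).
have jL : linear (fun a : int^o => (a : int) *: x).
  by move=> a b c; rewrite scalerDl scalerA.
have uL : linear (fun a : int^o => (a : int) *: QZpi n%:R^-1).
  by move=> a b c; rewrite scalerDl scalerA.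
pose j := mklinear jL; pose u := mklinear uL.
have [jbar jbarP] : exists g : {linear int^o -> submod (im_closed j)},
    forall a, submod_val _ (g a) = j a.
  by apply: corestrict => a; apply/asboolP; exists a.
have jbarS : surjective_lin jbar.
  move=> y; have /asboolP[a ay] := submod_valP y.
  by exists a; apply: submod_val_inj; rewrite jbarP.
have n0 : n%:R != 0 :> rat by rewrite pnatr_eq0 -lt0n ltnW.
have [w wP] : exists w : {linear submod (im_closed j) -> QZ},
    forall a, w (jbar a) = u a.
  apply: factor_surj => // a ja0.
  have /dvdnP[k ak] : (n %| `|(a : int)|)%N.
    by apply: Sn; rewrite -[LHS]/(j a) -jbarP ja0 linear0.
  rewrite -[LHS]/((a : int) *: QZpi n%:R^-1) QZpiZ; apply/QZpi_eq0.
  have -> : (a : int) = (-1) ^+ ((a : int) < 0)%R * k%:Z * n%:Z.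
    by rewrite {1}[a]intEsign ak PoszM mulrA.
  by rewrite rmorphM /= mulfK // rpred_int.
have [f fP] := QZ_injective w (@submod_val_inj _ _ _ (im_closed j)).
exists f; have <- : j 1 = x by rewrite -[LHS]/(1 *: x) scale1r.
rewrite -jbarP fP wP; apply/eqP.
rewrite -[LHS]/(1 *: QZpi n%:R^-1) scale1r => /QZpi_eq0 /intrP[m].
move=> /(congr1 (fun z => z * n%:R)); rewrite mulVf // => /eqP.
rewrite -[n%:R]/(n%:Z%:~R) -intrM -[1]/(1%:~R) eqr_int => /eqP/(congr1 absz).
by rewrite abszM /= => /esym/eqP; rewrite muln_eq1 (gtn_eqF n1) andbF.
Qed.

(** * Character modules *)

(** Left and right modules are compared along an abstract anti-isomorphism, so that [anti_flip]
    exchanges the two sides without identifying the opposite of A^c with A. *)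
Record anti_isomorphism (A B : pzRingType) := AntiIsomorphism {
  anti :> A -> B;
  anti_inv : B -> A;
  antiK : cancel anti anti_inv;
  anti_invK : cancel anti_inv anti;
  antiD : {morph anti : x y / x + y};
  antiM : forall x y, anti (x * y) = anti y * anti x;
  anti1 : anti 1 = 1
}.

Section AntiInverse.
Variables (A B : pzRingType) (e : anti_isomorphism A B).

Fact anti_invD : {morph anti_inv e : x y / x + y}.
Proof. by move=> x y; apply: (can_inj (antiK e)); rewrite antiD !anti_invK. Qed.
Fact anti_invM x y : anti_inv e (x * y) = anti_inv e y * anti_inv e x.
Proof. by apply: (can_inj (antiK e)); rewrite antiM !anti_invK. Qed.
Fact anti_inv1 : anti_inv e 1 = 1.
Proof. by apply: (can_inj (antiK e)); rewrite anti1 anti_invK. Qed.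
Definition anti_flip :=
  AntiIsomorphism (anti_invK e) (antiK e) anti_invD anti_invM anti_inv1.
End AntiInverse.

Definition anti_converse (A : pzRingType) : anti_isomorphism A A^c :=
  @AntiIsomorphism A A^c id id (fun _ => erefl) (fun _ => erefl)
    (fun _ _ => erefl) (fun _ _ => erefl) erefl.

Lemma additive_int_linear (V : zmodType) (W : lmodType int) (h : V -> W) :
  {morph h : x y / x + y} -> linear (h : zmodule V -> W).
Proof.
move=> hD; have hB : {morph h : x y / x - y}.
  by move=> x y; apply: (addIr (h y)); rewrite -hD !subrK.
pose ha : {additive V -> W} := HB.pack h (GRing.isZmodMorphism.Build V W h hB).
move=> a x y; have -> : h (a *: x + y) = h (x *~ a + y) by [].
by rewrite hD -[h (x *~ a)]/(ha (x *~ a)) raddfMz -scaler_int intz.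
Qed.

Section Characters.
Variables (A B : pzRingType) (e : anti_isomorphism A B) (Y : lmodType B).

Definition additive_pred : {pred zmodule Y -> QZ} :=
  fun h => `[< {morph h : x y / x + y} >].

Lemma additive_closed : GRing.submod_closed additive_pred.
Proof.
split=> [|a h h' /asboolP hD /asboolP hD']; apply/asboolP => x y.
  by rewrite [RHS]addr0.
by rewrite /GRing.add /GRing.scale /= -!/(GRing.add _ _) -!/(GRing.scale _ _)
  hD hD' scalerDr addrACA.
Qed.

(** The group Hom(Y, Q/Z). The argument selects the action (a h)(y) = h(e(a) y), which is again a
    left action because e reverses products. *)
Definition char of anti_isomorphism A B : Type := submod additive_closed.
Local Notation Y' := (char e).
HB.instance Definition _ := GRing.Zmodule.copy Y' (submod additive_closed).

Definition chval (h : Y') : Y -> QZ := submod_val additive_closed h.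

Lemma chval_inj (h k : Y') : (forall y, chval h y = chval k y) -> h = k.
Proof. by move=> E; apply: (@submod_val_inj _ _ _ additive_closed); exact: funext. Qed.

Lemma chvalD (h k : Y') y : chval (h + k) y = chval h y + chval k y.
Proof.
rewrite /chval.
by rewrite -[submod_val _ _]/(submod_val additive_closed ((h : submod _) + k)) linearD.
Qed.

Lemma chval_additive (h : Y') : {morph chval h : x y / x + y}.
Proof. by have /asboolP := submod_valP h. Qed.

Lemma exists_char (h : Y -> QZ) : {morph h : x y / x + y} ->
  exists k : Y', forall y, chval k y = h y.
Proof.
move=> hD; have hS : (h : zmodule Y -> QZ) \in additive_pred by apply/asboolP.
by have [k kh] := submod_in additive_closed hS; exists k => y; rewrite /chval kh.
Qed.

Fact char_scale_ex a (h : Y') : exists k : Y', forall y, chval k y = chval h (e a *: y).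
Proof.
by apply: exists_char => x y; rewrite scalerDr chval_additive.
Qed.

Definition char_scale a h : Y' := projT1 (cid (char_scale_ex a h)).

Fact char_scaleE a h y : chval (char_scale a h) y = chval h (e a *: y).
Proof. by rewrite /char_scale; case: cid. Qed.

Fact char_scaleA a b h : char_scale a (char_scale b h) = char_scale (a * b) h.
Proof. by apply: chval_inj => y; rewrite !char_scaleE scalerA antiM. Qed.
Fact char_scale1 : left_id 1 char_scale.
Proof. by move=> h; apply: chval_inj => y; rewrite char_scaleE anti1 scale1r. Qed.
Fact char_scaleDr : right_distributive char_scale +%R.
Proof. by move=> a h k; apply: chval_inj => y; rewrite !(char_scaleE, chvalD). Qed.
Fact char_scaleDl h : {morph char_scale^~ h : a b / a + b}.
Proof.
move=> a b; apply: chval_inj => y.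
by rewrite !(char_scaleE, chvalD) antiD scalerDl chval_additive.
Qed.
HB.instance Definition _ :=
  GRing.Zmodule_isLmodule.Build A Y' char_scaleA char_scale1 char_scaleDr char_scaleDl.

Definition char_module : lmodType A := Y'.

Lemma chvalP a (h k : char_module) y :
  chval (a *: h + k) y = chval h (e a *: y) + chval k y.
Proof. by rewrite chvalD char_scaleE. Qed.

Lemma chval0l y : chval (0 : char_module) y = 0.
Proof. by apply: (addIr (chval 0 y)); rewrite -chvalD !add0r. Qed.

Lemma chval0r (h : char_module) : chval h 0 = 0.
Proof. by apply: (addIr (chval h 0)); rewrite -chval_additive !add0r. Qed.

Lemma chvalZ a (h : char_module) y : chval (a *: h) y = chval h (e a *: y).
Proof. exact: char_scaleE. Qed.

Lemma chval_separates y : (forall h : char_module, chval h y = 0) -> y = 0.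
Proof.
move=> h0; apply: contrapT => /eqP y0.
have [f fy] := QZ_cogenerator (y0 : (y : zmodule Y) != 0).
have [k kf] := @exists_char f (linearD f).
by case/eqP: fy; rewrite -kf h0.
Qed.
End Characters.

Section CharacterMaps.
Variables (A B : pzRingType) (e : anti_isomorphism A B).
Implicit Types Y Z : lmodType B.

Lemma exists_char_map Y Z (f : {linear Y -> Z}) :
  exists g : {linear char_module e Z -> char_module e Y},
    forall h y, chval (g h) y = chval h (f y).
Proof.
apply: (@exists_linear _ _ _ (fun h k => forall y, chval k y = chval h (f y))).
  by move=> h; apply: exists_char => x y; rewrite linearD chval_additive.
move=> a h k h' k' z eh ek ez; apply: chval_inj => y.
by rewrite ez !chvalP eh ek linearZ.
Qed.

Definition char_map Y Z (f : {linear Y -> Z}) :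
  {linear char_module e Z -> char_module e Y} := projT1 (cid (exists_char_map f)).

Lemma char_mapE Y Z (f : {linear Y -> Z}) h y : chval (char_map f h) y = chval h (f y).
Proof. by rewrite /char_map; case: cid. Qed.

(** Characters are merely additive, so extending one along f is the injectivity of Q/Z over the
    integers. *)
Lemma char_map_surj Y Z (f : {linear Y -> Z}) :
  injective f -> surjective_lin (char_map f).
Proof.
move=> fI h.
pose i : {linear zmodule Y -> zmodule Z} :=
  mklinear (additive_int_linear (W := zmodule Z) (linearD f)).
pose k : {linear zmodule Y -> QZ} :=
  mklinear (additive_int_linear (chval_additive h)).
have [g gP] := QZ_injective k (fI : injective i).
have [g' gE] := @exists_char _ _ e Z g (linearD g).
by exists g'; apply: chval_inj => y; rewrite char_mapE gE; exact: gP.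
Qed.

Lemma char_short_exact (X Y Z : lmodType B) (f : {linear X -> Y}) (g : {linear Y -> Z}) :
  short_exact f g -> short_exact (char_map g) (char_map f).
Proof.
move=> [fI gS fg]; split; last 1 first.
- move=> h; split=> [h0|[k <-]]; last first.
    apply: chval_inj => x; rewrite !char_mapE (iffRL (fg _)) ?chval0l ?chval0r //.
    by exists x.
  have hk y y' : g y = g y' -> chval h y = chval h y'.
    move=> E; have /fg[x xE] : g (y - y') = 0 by rewrite linearB E subrr.
    rewrite -(subrK y' y) chval_additive -xE -char_mapE h0.
    by rewrite chval0l add0r.
  have [s sP] := choice gS.
  have [k kP] : exists k : char_module e Z, forall z, chval k z = chval h (s z).
    apply: exists_char => x y; rewrite -chval_additive; apply: hk.
    by rewrite linearD !sP.
  by exists k; apply: chval_inj => y; rewrite char_mapE kP; apply: hk; rewrite sP.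
- move=> h k E; apply: chval_inj => z; have [y <-] := gS z.
  by rewrite -!char_mapE E.
- exact: char_map_surj.
Qed.

(* The two sides of Hom_A(X, Y^+) = Hom_B(Y, X^+). *)
Lemma char_swap (X : lmodType A) Y (h : {linear X -> char_module e Y}) :
  exists k : {linear Y -> char_module (anti_flip e) X},
    forall x y, chval (k y) x = chval (h x) y.
Proof.
have [|b y z k k' w Ek Ek' Ew|k kP] := @exists_linear B Y (char_module (anti_flip e) X)
  (fun y k => forall x, chval k x = chval (h x) y).
- by move=> y; apply: exists_char => x x'; rewrite linearD chvalD.
- apply: chval_inj => x; rewrite Ew chvalP Ek Ek' chval_additive linearZ_LR chvalZ.
  by rewrite [e _]anti_invK.
- by exists k => x y; exact: kP.
Qed.
End CharacterMaps.

Section CharacterInjective.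
Variables (A B : pzRingType) (e : anti_isomorphism A B).

Lemma char_swap_inv (X : lmodType A) (Y : lmodType B)
    (k : {linear Y -> char_module (anti_flip e) X}) :
  exists h : {linear X -> char_module e Y},
    forall x y, chval (h x) y = chval (k y) x.
Proof.
have [|a x z h h' w Eh Eh' Ew|h hP] := @exists_linear A X (char_module e Y)
  (fun x h => forall y, chval h y = chval (k y) x).
- by move=> x; apply: exists_char => y y'; rewrite linearD chvalD.
- apply: chval_inj => y; rewrite Ew chvalP Eh Eh' chval_additive linearZ_LR chvalZ.
  by rewrite [anti_flip e _]antiK.
- by exists h.
Qed.

(** Under the swap, extending M -> F^+ along M -> N becomes lifting F -> M^+ through the surjection
    N^+ -> M^+. *)
Lemma char_injective (F : lmodType B) :
  projective_module F -> injective_module (char_module e F).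
Proof.
move=> FP M N i f iI; have [f' f'E] := char_swap f.
have [k kE] := FP _ _ (char_map (anti_flip e) i) f'
  (@char_map_surj _ _ (anti_flip e) _ _ i iI).
have [g gE] := char_swap_inv k.
exists g => x; apply: chval_inj => y.
by rewrite gE -f'E -kE char_mapE.
Qed.

(** Evaluation N -> N^++ is the swap of the identity of N^+; it is injective because characters
    separate points. *)
Lemma char_eval (N : lmodType A) :
  exists j : {linear N -> char_module e (char_module (anti_flip e) N)}, 
    injective j /\ forall x h, chval (j x) h = chval h x.
Proof.
have [j jE] := @char_swap_inv N (char_module (anti_flip e) N) idfun.
exists j; split=> //; apply: linear_inj => x jx0.
apply: (@chval_separates B A (anti_flip e)) => h.
by rewrite -[h]/(idfun h) -jE jx0 chval0l.
Qed.

End CharacterInjective.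

(** * Dimension shifting *)

Section DimensionShift.
Variable A : pzRingType.
Implicit Types K L M N P Q X I C : lmodType A.

(** The dual F^+ of a free cover F -> N^+. It contains N through N -> N^++ -> F^+; no essentiality
    is claimed. *)
Definition injective_hull N : lmodType A :=
  char_module (anti_converse A)
    (free_module A^c (char_module (anti_flip (anti_converse A)) N)).

Lemma injective_hull_injective N : injective_module (injective_hull N).
Proof. exact/char_injective/free_projective. Qed.

Lemma exists_hull_embedding N :
  exists j : {linear N -> injective_hull N}, injective j.
Proof.
have [j [jI _]] := char_eval (anti_converse A) N.
pose c := free_cover (char_module (anti_flip (anti_converse A)) N).
have [mI _ _] := char_short_exact (anti_converse A)
  (syzygy_short_exact _ : short_exact _ c).
by exists (char_map _ c \o j); apply: inj_comp.
Qed.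

Definition hull_embedding N : {linear N -> injective_hull N} :=
  projT1 (cid (exists_hull_embedding N)).

Lemma hull_embedding_inj N : injective (hull_embedding N).
Proof. by rewrite /hull_embedding; case: cid. Qed.

Definition cosyzygy N : lmodType A := quot (im_closed (hull_embedding N)).

Lemma cosyzygy_short_exact N :
  short_exact (hull_embedding N) (quot_proj (im_closed (hull_embedding N))).
Proof. exact: coker_short_exact (@hull_embedding_inj N). Qed.

(** [ext1_balanced] trades the presentations of K for one fixed copresentation of N, so a single
    presentation on either side decides the vanishing. *)
Lemma ext1_vanish_lift K N I C (i : {linear N -> I}) (c : {linear I -> C}) :
  short_exact i c -> injective_module I ->
  ext1_vanish K N <-> (forall h : {linear K -> C},
     exists u : {linear K -> I}, forall x, c (u x) = h x).
Proof.
move=> ic II; split=> [KN|lift L Q l q lq QP].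
  apply/(ext1_balanced (syzygy_short_exact K) ic _ II); first exact: free_projective.
  by apply: KN (syzygy_short_exact K) _; exact: free_projective.
by apply/(ext1_balanced lq ic QP II).
Qed.

Lemma ext1_vanish_extend L Q K N (l : {linear L -> Q}) (q : {linear Q -> K}) :
  short_exact l q -> projective_module Q ->
  ext1_vanish K N <-> (forall f : {linear L -> N},
     exists g : {linear Q -> N}, forall x, g (l x) = f x).
Proof.
move=> lq QP; split=> [KN|]; first exact: (KN _ _ _ _ lq QP).
have IN := @injective_hull_injective N.
move/(ext1_balanced lq (cosyzygy_short_exact N) QP IN).
by move/(ext1_vanish_lift _ (cosyzygy_short_exact N) IN).
Qed.

(** Both conditions concern the maps K -> C: the first lifts them to I, the second extends them to
    P. A lift extends to P since I is injective, and an extension lifts to I since P is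
    projective. *)
Lemma ext1_vanish_shift K P X N I C (k : {linear K -> P}) (p : {linear P -> X})
    (i : {linear N -> I}) (c : {linear I -> C}) :
  short_exact k p -> projective_module P -> short_exact i c -> injective_module I ->
  ext1_vanish K N <-> ext1_vanish X C.
Proof.
move=> kp PP ic II; rewrite (ext1_vanish_lift _ ic II) (ext1_vanish_extend _ kp PP).
have [kI _ _] := kp; have [_ cS _] := ic.
split=> H h; have [u uP] := H h.
  have [v vP] := II _ _ k u kI.
  by exists (c \o v) => x /=; rewrite vP uP.
have [v vP] := PP _ _ c u cS.
by exists (v \o k) => x /=; rewrite vP uP.
Qed.

Lemma ext1_vanish_syzygy_iter n X N :
  ext1_vanish (iter n (@syzygy A) X) N <-> ext1_vanish X (iter n cosyzygy N).
Proof.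
elim: n N => // n IH N; rewrite (iterSr n cosyzygy) iterS; apply: (iff_trans _ (IH _)).
apply: ext1_vanish_shift (syzygy_short_exact _) _ (cosyzygy_short_exact _) _.
  exact: free_projective.
exact: injective_hull_injective.
Qed.

(** * Dimensions *)

(** Resolutions of length at most n in recursive form, suited to induction by dimension shifting;
    [inj_dimE] identifies the result with [inj_dim]. *)
Fixpoint inj_dim_le n N : Prop :=
  if n isn't n'.+1 then injective_module N else
  exists I C (i : {linear N -> I}) (c : {linear I -> C}),
    [/\ short_exact i c, injective_module I & inj_dim_le n' C].

Fixpoint proj_dim_le n X : Prop :=
  if n isn't n'.+1 then projective_module X else
  exists K P (k : {linear K -> P}) (p : {linear P -> X}),
    [/\ short_exact k p, projective_module P & proj_dim_le n' K].

(** The given copresentations of N need not be the canonical ones. Passing to syzygies of X removes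
    the cosyzygies from the statement, after which any copresentation can be used for shifting. *)
Lemma inj_dim_le_ext1 n N X : inj_dim_le n N -> ext1_vanish X (iter n cosyzygy N).
Proof.
rewrite -ext1_vanish_syzygy_iter; elim: n N => [|n IH] N /=.
  exact: ext1_vanish_injective.
move=> [I [C [i [c [ic II /IH]]]]].
apply: (iffRL (ext1_vanish_shift (syzygy_short_exact _) _ ic II)).
exact: free_projective.
Qed.

Lemma inj_dim_le_cosyzygy n N :
  injective_module (iter n cosyzygy N) -> inj_dim_le n N.
Proof.
elim: n N => // n IH N; rewrite iterSr => /IH NI.
exists (injective_hull N), (cosyzygy N), (hull_embedding N), (quot_proj _).
by split=> //; [exact: cosyzygy_short_exact|exact: injective_hull_injective].
Qed.

Lemma proj_dim_le_ext1 n X N : proj_dim_le n X -> ext1_vanish X (iter n cosyzygy N).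
Proof.
elim: n X N => [|n IH] X N /=; first exact: ext1_vanish_projective.
move=> [K [P [k [p [kp PP /IH KN]]]]].
apply: (iffLR (ext1_vanish_shift kp PP (cosyzygy_short_exact _) _)).
  exact: injective_hull_injective.
exact: KN.
Qed.

Lemma proj_dim_le_syzygy n X :
  projective_module (iter n (@syzygy A) X) -> proj_dim_le n X.
Proof.
elim: n X => // n IH X; rewrite iterSr => /IH XP.
exists (syzygy X), (free_module A X), (submod_val _), (free_cover X).
by split=> //; [exact: syzygy_short_exact|exact: free_projective].
Qed.

(** By dimension shifting this is Ext^{n+1} = 0 on all pairs, a form from which bounds on projective
    and on injective dimensions both follow. *)
Definition gl_dim_le n := forall X N, ext1_vanish X (iter n cosyzygy N).

Lemma gl_dim_le_proj n : gl_dim_le n <-> forall X, proj_dim_le n X.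
Proof.
split=> [G X|H X N]; last exact: proj_dim_le_ext1.
apply/proj_dim_le_syzygy/projective_of_ext1_vanish => N.
exact/ext1_vanish_syzygy_iter.
Qed.

Lemma gl_dim_le_inj n N : gl_dim_le n -> inj_dim_le n N.
Proof.
move=> G; apply: inj_dim_le_cosyzygy; apply: injective_of_ext1_vanish => X _.
exact: G.
Qed.

(* Auslander: Baer's criterion only tests against cyclic modules. *)
Lemma gl_dim_le_fg n :
  (forall X N, finitely_generated X -> ext1_vanish X (iter n cosyzygy N)) ->
  gl_dim_le n.
Proof.
move=> H X N; apply: ext1_vanish_injective; apply: injective_of_ext1_vanish => Y Yfg.
exact: H.
Qed.
End DimensionShift.

(** * Resolutions *)

Section Resolutions.
Variable A : pzRingType.
Implicit Types K M N P X I C : lmodType A.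

Definition zero_module : lmodType A := {ffun 'I_0 -> A^o}.

Lemma zero_moduleP (x : zero_module) : x = 0.
Proof. by apply/ffunP => -[]. Qed.

Lemma injective_module0 M : (forall x : M, x = 0) -> injective_module M.
Proof.
move=> M0 U V i f iI; exists \0 => x /=.
by rewrite [RHS]M0.
Qed.

Lemma projective_module0 M : (forall x : M, x = 0) -> projective_module M.
Proof.
move=> M0 U V p f pS; exists \0 => x /=.
by rewrite linear0 [x]M0 linear0.
Qed.

Definition zero_map M N : {linear M -> N} := \0.

Definition zero_ires : injective_resolution zero_module.
Proof.
apply: (@InjectiveResolution _ _ (fun=> zero_module)
  (fun=> zero_map zero_module zero_module) (zero_map zero_module zero_module)).
- by move=> _; exact/injective_module0/zero_moduleP.
- by move=> x y _; rewrite [x]zero_moduleP [y]zero_moduleP.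
- by move=> y; split=> // _; exists 0; rewrite [RHS]zero_moduleP.
- by move=> _ y; split=> // _; exists 0; rewrite [RHS]zero_moduleP.
Defined.

Definition zero_pres : projective_resolution zero_module.
Proof.
apply: (@ProjectiveResolution _ _ (fun=> zero_module)
  (fun=> zero_map zero_module zero_module) (zero_map zero_module zero_module)).
- by move=> _; exact/projective_module0/zero_moduleP.
- by move=> x; exists 0; rewrite [RHS]zero_moduleP.
- by move=> y; split=> // _; exists 0; rewrite [RHS]zero_moduleP.
- by move=> _ y; split=> // _; exists 0; rewrite [RHS]zero_moduleP.
Defined.

Definition cons_ires M I C (i : {linear M -> I}) (c : {linear I -> C})
    (ic : short_exact i c) (II : injective_module I)
    (r : injective_resolution C) : injective_resolution M.
Proof.
pose mods k : lmodType A := if k is k'.+1 then ires_mod r k' else I.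
pose diff k : {linear mods k -> mods k.+1} :=
  match k with 0 => ires_coaug r \o c | k'.+1 => ires_diff r k' end.
apply: (@InjectiveResolution _ _ mods diff i).
- by case=> [|k]; [exact: II|exact: ires_injective].
- by case: ic.
- have [_ _ E] := ic; move=> y.
  rewrite -E; split=> [h|cy /=]; last by rewrite cy linear0.
  exact: inj_eq0 (@ires_coaug_inj _ _ r) h.
- have [_ cS _] := ic; case=> [|k] y /=; last exact: ires_exact.
  rewrite ires_exact0; split=> [[x <-]|[x <-]]; last by exists (c x).
  by have [z <-] := cS x; exists z.
Defined.

Definition cons_pres K P X (k : {linear K -> P}) (p : {linear P -> X})
    (kp : short_exact k p) (PP : projective_module P)
    (r : projective_resolution K) : projective_resolution X.
Proof.
pose mods j : lmodType A := if j is j'.+1 then pres_mod r j' else P.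
pose diff j : {linear mods j.+1 -> mods j} :=
  match j with 0 => k \o pres_aug r | j'.+1 => pres_diff r j' end.
apply: (@ProjectiveResolution _ _ mods diff p).
- by case=> [|j]; [exact: PP|exact: pres_projective].
- by case: kp.
- have [_ _ E] := kp; move=> y.
  rewrite E; split=> [[x <-]|[x <-]]; last by exists (pres_aug r x).
  by have [z <-] := pres_aug_surj r x; exists z.
- have [kI _ _] := kp; case=> [|j] y /=; last exact: pres_exact.
  rewrite -pres_exact0; split=> [h|-> /=]; last by rewrite linear0.
  exact: inj_eq0 kI h.
Defined.

Lemma zero_short_exact_r M : short_exact (idfun : {linear M -> M}) (zero_map M zero_module).
Proof.
split=> // [y|y]; first by exists 0; rewrite [RHS]zero_moduleP.
by split=> // _; exists y.
Qed.

Lemma zero_short_exact_l M : short_exact (zero_map zero_module M) (idfun : {linear M -> M}).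
Proof.
split=> [x y _|y|y]; first by rewrite [x]zero_moduleP [y]zero_moduleP.
  by exists y.
by split=> [y0|[x <-]] //; exists 0; exact: esym y0.
Qed.

Lemma inj_dim_le_resolution n M : inj_dim_le n M ->
  exists r : injective_resolution M,
    forall i, (n < i)%N -> forall x : ires_mod r i, x = 0.
Proof.
elim: n M => [|n IH] M /=.
  move=> MI; exists (cons_ires (zero_short_exact_r M) MI zero_ires) => -[|i] //= _ x.
  exact: (zero_moduleP x).
move=> [I [C [i [c [ic II /IH[r r0]]]]]].
by exists (cons_ires ic II r) => -[|j] //=; exact: r0.
Qed.

Lemma proj_dim_le_resolution n X : proj_dim_le n X ->
  exists r : projective_resolution X,
    forall i, (n < i)%N -> forall x : pres_mod r i, x = 0.
Proof.
elim: n X => [|n IH] X /=.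
  move=> XP; exists (cons_pres (zero_short_exact_l X) XP zero_pres) => -[|i] //= _ x.
  exact: (zero_moduleP x).
move=> [K [P [k [p [kp PP /IH[r r0]]]]]].
by exists (cons_pres kp PP r) => -[|j] //=; exact: r0.
Qed.

(** By exactness the kernel of the differential leaving degree 1 is the image of the previous one,
    that is, the first cosyzygy of M along r. *)
Definition tail_ires M (r : injective_resolution M) :
  injective_resolution (submod (ker_closed (ires_diff r 1%N))).
Proof.
apply: (@InjectiveResolution _ _ (fun i => ires_mod r i.+1)
  (fun i => ires_diff r i.+1) (submod_val _)).
- by move=> i; exact: ires_injective.
- exact: submod_val_inj.
- move=> y; rewrite -ker_predP; split=> [|[x <-]]; [exact: submod_in|exact: submod_valP].
- by move=> i; exact: ires_exact.
Defined.

Lemma resolution_inj_dim_le n M (r : injective_resolution M) :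
  (forall i, (n < i)%N -> forall x : ires_mod r i, x = 0) -> inj_dim_le n M.
Proof.
elim: n M r => [|n IH] M r r0 /=.
  apply: (injective_module_iso (@ires_coaug_inj _ _ r)); last exact: ires_injective.
  by move=> y; apply/ires_exact0; apply: r0.
have [c cE] :
    exists c : {linear ires_mod r 0%N -> submod (ker_closed (ires_diff r 1%N))},
    forall x, submod_val _ (c x) = ires_diff r 0%N x.
  by apply: corestrict => x; apply/ker_predP/ires_exact; exists x.
exists (ires_mod r 0%N), (submod (ker_closed (ires_diff r 1%N))), (ires_coaug r), c.
split; last by apply: (IH _ (tail_ires r)) => i ni; exact: r0.
  split; first exact: ires_coaug_inj.
    move=> y; have /ires_exact[x xy] := (iffLR (ker_predP _ _) (submod_valP y)).
    by exists x; apply: submod_val_inj; rewrite cE.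
  move=> y; rewrite -ires_exact0 -cE.
  by split=> [->|/(inj_eq0 (@submod_val_inj _ _ _ _))//]; rewrite linear0.
exact: ires_injective.
Qed.

(** The corestricted differential is an argument since [corestrict] provides it only as an
    existential statement, while a resolution is data. *)
Definition tail_pres X (r : projective_resolution X)
    (d : {linear pres_mod r 1%N -> submod (ker_closed (pres_aug r))}) 
    (dE : forall x, submod_val _ (d x) = pres_diff r 0%N x) :
  projective_resolution (submod (ker_closed (pres_aug r))).
Proof.
apply: (@ProjectiveResolution _ _ (fun i => pres_mod r i.+1)
  (fun i => pres_diff r i.+1) d).
- by move=> i; exact: pres_projective.
- move=> y; have /pres_exact0[x xy] := (iffLR (ker_predP _ _) (submod_valP y)).
  by exists x; apply: submod_val_inj; rewrite dE.
- move=> y; rewrite -pres_exact -dE.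
  by split=> [->|/(inj_eq0 (@submod_val_inj _ _ _ _))//]; rewrite linear0.
- by move=> i; exact: pres_exact.
Defined.

Lemma resolution_proj_dim_le n X (r : projective_resolution X) :
  (forall i, (n < i)%N -> forall x : pres_mod r i, x = 0) -> proj_dim_le n X.
Proof.
elim: n X r => [|n IH] X r r0 /=.
  apply: (projective_module_iso (f := pres_aug r)); last exact: pres_projective.
    apply: linear_inj => y /pres_exact0[x <-].
    by rewrite [x](r0 1%N) // linear0.
  exact: pres_aug_surj.
have [d dE] :
    exists d : {linear pres_mod r 1%N -> submod (ker_closed (pres_aug r))},
    forall x, submod_val _ (d x) = pres_diff r 0%N x.
  by apply: corestrict => x; apply/ker_predP/pres_exact0; exists x.
exists (submod (ker_closed (pres_aug r))), (pres_mod r 0%N),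
  (submod_val _), (pres_aug r).
split; first by apply: ker_short_exact; exact: pres_aug_surj.
  exact: pres_projective.
by apply: (IH _ (tail_pres dE)) => i ni; exact: r0.
Qed.

Lemma inj_dimE M : inj_dim M = least (fun n => inj_dim_le n M).
Proof.
congr least; apply/funext => n; apply/propext; split; last exact: inj_dim_le_resolution.
by move=> [r]; exact: resolution_inj_dim_le.
Qed.

Lemma dim_le_least (Q : nat -> Prop) n :
  (forall m, (m <= n)%N -> Q m -> Q n) -> dim_le (least Q) n <-> Q n.
Proof.
move=> Qle; rewrite /least; case: pselect => [exQ|nQ] /=.
  case: ex_minnP => m /asboolP Qm mmin; split=> [mn|Qn]; first exact: Qle mn Qm.
  exact/mmin/asboolP.
by split=> // Qn; apply: nQ; exists n; exact/asboolP.
Qed.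

Lemma proj_dim_leE X n : dim_le (proj_dim X) n <-> proj_dim_le n X.
Proof.
rewrite /proj_dim dim_le_least => [|m mn [r r0]]; last first.
  by exists r => i ni; apply: r0; exact: leq_ltn_trans mn ni.
split; last exact: proj_dim_le_resolution.
by move=> [r]; exact: resolution_proj_dim_le.
Qed.

Lemma gl_dimE : gl_dim A = least (@gl_dim_le A).
Proof.
congr least; apply/funext => n; apply/propext; rewrite gl_dim_le_proj.
by split=> H X; apply/proj_dim_leE.
Qed.
End Resolutions.

(** * Finitely generated modules over noetherian rings *)

Section FinitelyGenerated.
Variable A : pzRingType.
Implicit Types K M N P X : lmodType A.

Lemma fg_free_cover M : finitely_generated M ->
  exists n (p : {linear free_module A 'I_n -> M}), surjective_lin p.
Proof.
move=> [n [v vP]]; have [p pE] := @free_lift A 'I_n M v; exists n, p => x.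
have [a ->] := vP x; exists (\sum_i a i *: delta A i).
by rewrite linear_sum; apply: eq_bigr => i _; rewrite linearZ /= pE.
Qed.

Lemma fg_free n : finitely_generated (free_module A 'I_n).
Proof.
exists n, (@delta A 'I_n) => x; exists (coef x).
apply: free_expand; first exact: index_enum_uniq.
by move=> t; rewrite mem_index_enum.
Qed.

(** The f i are the coordinates of a section of the surjection A^n -> P defined by v. *)
Lemma fg_dual_basis P n (v : 'I_n -> P) : projective_module P ->
  (forall x, exists a : 'I_n -> A, x = \sum_i a i *: v i) ->
  exists f : 'I_n -> {linear P -> A^o}, forall x, x = \sum_i (f i x : A) *: v i.
Proof.
move=> PP vP; have [p pE] := @free_lift A 'I_n P v.
have pS : surjective_lin p.
  move=> x; have [a ->] := vP x; exists (\sum_i a i *: delta A i).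
  by rewrite linear_sum; apply: eq_bigr => i _; rewrite linearZ /= pE.
have [s sK] := projective_section PP pS.
have fL i : linear (fun x => coef (s x) i : A^o).
  by move=> a x y; rewrite linearP coefP.
exists (fun i => mklinear (fL i)) => x; rewrite -{1}[x]sK.
rewrite {1}(@free_expand _ _ (s x) (index_enum 'I_n)) ?index_enum_uniq //.
  by rewrite linear_sum; apply: eq_bigr => i _; rewrite linearZ /= pE.
by move=> t; rewrite mem_index_enum.
Qed.

Let span (M : lmodType A) (s : seq M) : {pred M} :=
  fun x => `[< exists c : nat -> A, x = \sum_(i < size s) c i *: s`_i >].

Let span_closed M (s : seq M) : GRing.submod_closed (span s).
Proof.
split=> [|a _ _ /asboolP[c ->] /asboolP[d ->]]; apply/asboolP.
  by exists (fun=> 0); rewrite big1 // => i _; rewrite scale0r.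
exists (fun i => a * c i + d i); rewrite scaler_sumr -big_split /=.
by apply: eq_bigr => i _; rewrite scalerDl scalerA.
Qed.

Let span_rcons M (s : seq M) x : {subset span s <= span (rcons s x)}.
Proof.
move=> _ /asboolP[c ->]; apply/asboolP.
exists (fun i => if (i < size s)%N then c i else 0).
rewrite size_rcons big_ord_recr /= ltnn scale0r addr0.
by apply: eq_bigr => i _; rewrite ltn_ord nth_rcons ltn_ord.
Qed.

Let span_last M (s : seq M) x : x \in span (rcons s x).
Proof.
apply/asboolP; exists (fun i => (i == size s)%:R).
rewrite size_rcons big_ord_recr /= eqxx nth_rcons ltnn eqxx scale1r.
rewrite big1 ?add0r // => i _.
by rewrite (ltn_eqF (ltn_ord i)) scale0r.
Qed.

Lemma noetherian_submodule M (S : {pred M}) :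
  noetherian_module M -> GRing.submod_closed S ->
  exists n (v : 'I_n -> M), (forall i, v i \in S) /\
    forall x, x \in S -> exists a : 'I_n -> A, x = \sum_i a i *: v i.
Proof.
move=> Mnoeth Sc; apply: contrapT => nfg.
(* If S is not finitely generated, every list in S can be lengthened outside its span. The condition
   on s sits inside the existential so that [choice] gives a function on all lists, which is then
   iterated to a strictly ascending chain. *)
have next (s : seq M) : exists x, all (fun z => z \in S) s -> x \in S /\ x \notin span s.
  apply: contrapT => nx; have sS : all (fun z => z \in S) s.
    by apply: contrapT => ns; apply: nx; exists 0 => /ns.
  apply: nfg; exists (size s), (fun i => s`_i); split=> [i|x xS].
    by move/allP: sS; apply; apply: mem_nth.
  have /asboolP[c ->] : x \in span s.
    by apply: contrapT => /negP xs; apply: nx; exists x.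
  by exists c.
have [nx nxP] := choice next.
pose s k := iter k (fun s => rcons s (nx s)) [::].
have sS k : all (fun z => z \in S) (s k).
  by elim: k => //= k IH; rewrite all_rcons IH andbT; case: (nxP _ IH).
have [|n nP] := Mnoeth (fun k => span (s k)) (fun k => span_closed (s k)).
  by move=> k; exact: span_rcons.
have [_ /negP] := nxP _ (sS n); apply.
by rewrite -(nP n.+1) //; exact: span_last.
Qed.

Hypothesis Anoeth : noetherian_module (A^o : lmodType A).

(** Induction on n. The coefficients at v_0 of elements of S form a left ideal, which is finitely
    generated; lifts to S of its generators, together with generators of the part of S spanned by
    the other v_i, generate S. *)
Lemma noetherian_fg_submodule M n (v : 'I_n -> M) (S : {pred M}) :
  GRing.submod_closed S ->
  (forall x, x \in S -> exists a : 'I_n -> A, x = \sum_i a i *: v i) ->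
  exists m (w : 'I_m -> M), (forall i, w i \in S) /\
    forall x, x \in S -> exists a : 'I_m -> A, x = \sum_i a i *: w i.
Proof.
elim: n v S => [|n IH] v S Sc Sv.
  exists 0%N, (fun=> 0); split=> [[]//|x /Sv[a ->]].
  by exists (fun=> 0); rewrite !big_ord0.
pose tail (c : 'I_n -> A) := \sum_i c i *: v (lift ord0 i).
have tailP a c d : tail (fun i => a * c i + d i) = a *: tail c + tail d.
  rewrite /tail scaler_sumr -big_split /=.
  by apply: eq_bigr => i _; rewrite scalerDl scalerA.
have tail0 : tail (fun=> 0) = 0 by rewrite /tail big1 // => i _; rewrite scale0r.
pose I : {pred A^o} := fun a : A => `[< exists c, a *: v ord0 + tail c \in S >].
have Ic : GRing.submod_closed I.
  split=> [|a x y /asboolP[c cS] /asboolP[d dS]]; apply/asboolP.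
    by exists (fun=> 0); rewrite scale0r add0r tail0 (closed0 Sc).
  exists (fun i => a * c i + d i); have [_ SL] := Sc.
  have -> : (a *: x + y : A) *: v ord0 + tail (fun i => a * c i + d i) =
      a *: ((x : A) *: v ord0 + tail c) + ((y : A) *: v ord0 + tail d).
    by rewrite tailP scalerDl -scalerA scalerDr addrACA.
  exact: SL.
have [k [u [uI Iu]]] := noetherian_submodule Anoeth Ic.
have [c cP] := choice (fun j => asboolW (uI j)).
pose y j := (u j : A) *: v ord0 + tail (c j).
pose S' : {pred M} := fun x => (x \in S) && `[< exists d, x = tail d >].
have S'c : GRing.submod_closed S'.
  split=> [|a x z /andP[xS /asboolP[d xd]] /andP[zS /asboolP[d' zd]]].
    by rewrite unfold_in /S' (closed0 Sc) /=; apply/asboolP; exists (fun=> 0).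
  rewrite unfold_in /S'; apply/andP; split.
    by have [_ SL] := Sc; apply: SL.
  by apply/asboolP; exists (fun i => a * d i + d' i); rewrite tailP xd zd.
have [|m [w [wS' S'w]]] := IH (fun i => v (lift ord0 i)) S' S'c.
  by move=> x /andP[_ /asboolP[d ->]]; exists d.
pose W (i : 'I_(k + m)) := match fintype.split i with inl j => y j | inr j => w j end.
exists (k + m)%N, W; split=> [i|x xS].
  by rewrite /W; case: (fintype.split i) => j; [exact: cP|case/andP: (wS' j)].
have [a xa] := Sv x xS.
have aI : a ord0 \in I.
  apply/asboolP; exists (fun i => a (lift ord0 i)).
  by move: xS; rewrite xa big_ord_recl.
have [b ab] := Iu _ aI.
have xS' : x - \sum_j b j *: y j \in S'.
  rewrite unfold_in /S' (closedB Sc xS) /=; last first.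
    by apply: (closed_sum Sc) => j; apply: (closedZ Sc); exact: cP.
  apply/asboolP; exists (fun i => a (lift ord0 i) - \sum_j b j * c j i).
  rewrite xa big_ord_recl -/(tail (fun i => a (lift ord0 i))) ab.
  have -> : \sum_j b j *: y j =
      (\sum_j b j *: u j : A) *: v ord0 + tail (fun i => \sum_j b j * c j i).
    rewrite scaler_suml /tail.
    under [X in _ = _ + X]eq_bigr do rewrite scaler_suml.
    rewrite exchange_big -big_split /=; apply: eq_bigr => j _.
    rewrite /y scalerDr scalerA; congr (_ + _).
    by rewrite scaler_sumr; apply: eq_bigr => i _; rewrite scalerA.
  rewrite opprD addrACA subrr add0r.
  by rewrite /tail -sumrB; apply: eq_bigr => i _; rewrite scalerBl.
have [d xd] := S'w _ xS'.
exists (fun i => match fintype.split i with inl j => b j | inr j => d j end).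
rewrite big_split_ord /= /W.
under eq_bigr do rewrite (unsplitK (inl _)).
under [X in _ = _ + X]eq_bigr do rewrite (unsplitK (inr _)).
by rewrite -xd addrC subrK.
Qed.

Lemma noetherian_fg_ker M N (f : {linear M -> N}) :
  finitely_generated M -> finitely_generated (submod (ker_closed f)).
Proof.
move=> [n [v vP]].
have [m [w [wS Sw]]] := noetherian_fg_submodule (ker_closed f) (fun x _ => vP x).
have [u uE] := choice (fun i => submod_in (ker_closed f) (wS i)).
exists m, u => x; have [a ax] := Sw _ (submod_valP x); exists a.
apply: submod_val_inj; rewrite ax linear_sum.
by apply: eq_bigr => i _; rewrite linearZ_LR uE.
Qed.

(** [syzygy] comes from the free module on all elements and is not finitely generated in general.
    Kernels of finite free covers replace it, and only their Ext behaviour is recorded. *)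
Lemma fg_syzygy n X : finitely_generated X -> exists2 K, finitely_generated K &
  forall N, ext1_vanish K N <-> ext1_vanish X (iter n (@cosyzygy A) N).
Proof.
move=> Xfg; elim: n => [|n [K Kfg KX]]; first by exists X.
have [m [p pS]] := fg_free_cover Kfg.
exists (submod (ker_closed p)); first exact: noetherian_fg_ker (fg_free m).
move=> N; rewrite iterSr; apply: iff_trans (KX _).
apply: ext1_vanish_shift (ker_short_exact pS) _ (cosyzygy_short_exact N) _.
  exact: free_projective.
exact: injective_hull_injective.
Qed.
End FinitelyGenerated.

(** * The Jacobson radical *)

Section Jacobson.
Variable A : pzRingType.
Implicit Types K M N : lmodType A.

Let Jc : GRing.submod_closed (jacobson A) := jacobson_submod A.

Lemma exists_maximal_left_ideal (S : {pred A^o}) :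
  GRing.submod_closed S -> (1 : A^o) \notin S ->
  exists2 T : {pred A^o}, maximal_submodule T & {subset S <= T}.
Proof.
(* As with graphs, adjoining S takes care of the empty chain. *)
move=> Sc S1; pose U (X : set A^o) : {pred A^o} := fun x => `[< X x >] || (x \in S).
pose P X := GRing.submod_closed (U X) /\ (1 : A^o) \notin U X.
have US X : {subset S <= U X} by move=> x xS; rewrite unfold_in /U xS orbT.
have [F FP Ftot|X [[Uc U1] Xmax]] := @Zorn_bigcup _ P.
  pose V := (\bigcup_(X in F) X)%classic.
  have one X : F X -> {subset U X <= U V}.
    move=> FX x /orP[/asboolP Xx|/US//]; apply/orP; left; apply/asboolP.
    by exists X.
  have lift x y : x \in U V -> y \in U V -> x \in S /\ y \in S \/
      exists2 X, F X & x \in U X /\ y \in U X.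
    have UX X z : X z -> z \in U X by move=> ?; apply/orP; left; apply/asboolP.
    move=> /orP[/asboolP[X FX Xx]|xS] /orP[/asboolP[Y FY Yy]|yS].
    - right; have [XY|YX] := Ftot _ _ FX FY.
        by exists Y => //; split; apply: UX => //; exact: XY.
      by exists X => //; split; apply: UX => //; exact: YX.
    - by right; exists X => //; split; [exact: UX|exact: US].
    - by right; exists Y => //; split; [exact: US|exact: UX].
    - by left.
  split; [split=> [|a x y xV yV]|apply/negP => V1].
  - by apply: US; exact: (closed0 Sc).
  - have [[xS yS]|[X FX [xX yX]]] := lift _ _ xV yV.
      by apply: US; have [_ SL] := Sc; exact: SL.
    by apply: (one _ FX); have [[_ XL] _] := FP _ FX; exact: XL.
  - have [[/(negP S1)]//|[X FX [X1 _]]] := lift _ _ V1 V1.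
    by have [_ /negP] := FP _ FX; exact.
exists (U X); last exact: US.
split=> //; first by exists 1.
move=> T Tc UT; have [T1|T1] := boolP ((1 : A^o) \in T); [right|left] => x.
  by have := closedZ Tc (x : A) T1; rewrite [_ *: _]mulr1.
apply/idP/idP => [xT|/UT//]; apply: contrapT => /negP xU.
apply: (Xmax (fun z => z \in T)).
  split=> [z Xz|TX]; first by apply: UT; apply/orP; left; apply/asboolP.
  by case/negP: xU; apply/orP; left; apply/asboolP; exact: TX.
have UE : U (fun z => z \in T) = T.
  apply/funext => z; apply/idP/idP => [/orP[/asboolP//|zS]|zT].
    by apply: UT; exact: US.
  by apply/orP; left; apply/asboolP.
by rewrite /P UE.
Qed.

Lemma maximal_submodule_sum M (S : {pred M}) y : maximal_submodule S -> y \notin S ->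
  forall z, exists s b, s \in S /\ z = s + b *: y.
Proof.
move=> [Sc _ Smax] yS.
pose T : {pred M} := fun z => `[< exists s b, s \in S /\ z = s + b *: y >].
have Tc : GRing.submod_closed T.
  split=> [|a _ _ /asboolP[s [b [sS ->]]] /asboolP[t [c [tS ->]]]]; apply/asboolP.
    by exists 0, 0; rewrite scale0r addr0 (closed0 Sc).
  exists (a *: s + t), (a * b + c); split; first by have [_ SL] := Sc; exact: SL.
  by rewrite scalerDr scalerDl scalerA addrACA.
have [|TS z|Tall z] := Smax T Tc.
- by move=> s sS; apply/asboolP; exists s, 0; rewrite scale0r addr0.
- have : y \in T by apply/asboolP; exists 0, 1; rewrite scale1r add0r (closed0 Sc).
  by rewrite TS (negPf yS).
- by have /asboolP := Tall z.
Qed.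

(** Otherwise the left ideal A(1 - x) lies in a maximal one, which contains x as well and therefore
    1. *)
Lemma jacobson_left_inverse (x : A) :
  (x : A^o) \in jacobson A -> exists u, u * (1 - x) = 1.
Proof.
move=> xJ; pose S : {pred A^o} := fun z : A => `[< exists u, z = u * (1 - x) >].
have Sc : GRing.submod_closed S.
  split=> [|a _ _ /asboolP[u ->] /asboolP[v ->]]; apply/asboolP.
    by exists 0; rewrite mul0r.
  by exists (a * u + v); rewrite mulrDl -mulrA.
have [/asboolP[u e]|S1] := boolP ((1 : A^o) \in S); first by exists u.
have [T Tmax ST] := exists_maximal_left_ideal Sc S1.
have [Tc [z zT] _] := Tmax; case/negP: zT.
have T1 : (1 : A^o) \in T.
  have /asboolP xT := xJ; rewrite -[1](subrK (x : A^o)).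
  apply: (closedD Tc); last exact: xT.
  by apply: ST; apply/asboolP; exists 1; rewrite mul1r.
by have := closedZ Tc (z : A) T1; rewrite [_ *: _]mulr1.
Qed.

(* The left inverse of 1 - x is itself of the form 1 - y with y in the radical. *)
Lemma jacobson_right_inverse (x : A) :
  (x : A^o) \in jacobson A -> exists u, (1 - x) * u = 1.
Proof.
move=> xJ; have [u ux] := jacobson_left_inverse xJ.
have uxJ : (- (u * x) : A^o) \in jacobson A.
  exact: (closedN Jc (closedZ Jc u xJ)).
have uE : u = 1 - - (u * x).
  by rewrite opprK -[X in X + _]ux mulrBr mulr1 subrK.
have [v] := jacobson_left_inverse uxJ; rewrite -uE => vu.
exists u; suff <- : v = 1 - x by [].
transitivity (v * (u * (1 - x))); first by rewrite ux mulr1.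
by rewrite mulrA vu mul1r.
Qed.

(** Gaussian elimination: a left inverse of 1 - c_0 expresses v_0 modulo S through the other v_j
    with coefficients in the radical, and substitution leaves one element fewer. Stated with
    elements, it applies both to images of maps and to the zero submodule. *)
Lemma nakayama M k (v : 'I_k -> M) (S : {pred M}) : GRing.submod_closed S ->
  (forall i, exists c : 'I_k -> A, (forall j, (c j : A^o) \in jacobson A) /\
     v i - \sum_j c j *: v j \in S) ->
  forall i, v i \in S.
Proof.
move=> Sc; elim: k v => [|k IH] v vS; first by case.
have [c [cJ c0S]] := vS ord0.
have [u uc] := jacobson_left_inverse (cJ ord0).
pose w i := v (lift ord0 i).
pose d (j : 'I_k) := u * c (lift ord0 j).
have dJ j : (d j : A^o) \in jacobson A by exact: (closedZ Jc u (cJ _)).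
have v0S : v ord0 - \sum_j d j *: w j \in S.
  have -> : v ord0 - \sum_j d j *: w j = u *: (v ord0 - \sum_j c j *: v j).
    rewrite big_ord_recl opprD addrA scalerBr -[X in X - c ord0 *: _]scale1r.
    rewrite -scalerBl scalerA uc scale1r scaler_sumr.
    by under [in RHS]eq_bigr do rewrite scalerA.
  exact: (closedZ Sc).
have wS i : w i \in S.
  apply: IH => {}i; have [b [bJ biS]] := vS (lift ord0 i).
  exists (fun j => b (lift ord0 j) + b ord0 * d j); split=> [j|].
    apply: (closedD Jc) => //; exact: (closedZ Jc (b ord0) (dJ j)).
  have -> : w i - \sum_j (b (lift ord0 j) + b ord0 * d j) *: w j =
      (v (lift ord0 i) - \sum_j b j *: v j) + b ord0 *: (v ord0 - \sum_j d j *: w j).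
    have -> : \sum_j (b (lift ord0 j) + b ord0 * d j) *: w j =
        \sum_j b (lift ord0 j) *: w j + b ord0 *: \sum_j d j *: w j.
      rewrite scaler_sumr -big_split /=.
      by apply: eq_bigr => j _; rewrite scalerDl scalerA.
    by rewrite big_ord_recl scalerBr (addrC (b ord0 *: _)) !opprD !addrA subrK.
  by apply: (closedD Sc) => //; exact: (closedZ Sc).
move=> i; case: (unliftP ord0 i) => [j ->|->]; first exact: wS.
rewrite -(subrK (\sum_j d j *: w j) (v ord0)); apply: (closedD Sc) => //.
by apply: (closed_sum Sc) => j; exact: (closedZ Sc).
Qed.

(** If f x avoids a maximal left ideal S, then A = S + A f(x) gives P = f^{-1}(S) + ker p, so
    f^{-1}(S) = P contains x, a contradiction. *)
Lemma superfluous_kernel_jacobson (P M : lmodType A) (p : {linear P -> M})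
    (f : {linear P -> A^o}) x :
  superfluous_kernel p -> p x = 0 -> f x \in jacobson A.
Proof.
move=> psup px; apply/asboolP => S Smax; apply: contrapT => /negP fxS.
have [Sc _ _] := Smax.
pose T : {pred P} := fun y => f y \in S.
have Tc : GRing.submod_closed T.
  have [S0 SL] := Sc.
  split=> [|a y z yT zT]; rewrite unfold_in /T ?linear0 // linearP.
  exact: SL.
have /negP := fxS; apply; apply: (psup T Tc) => y.
have [s [b [sS e]]] := maximal_submodule_sum Smax fxS (f y).
exists (y - b *: x), (b *: x); rewrite subrK linearZ_LR px scaler0; split=> //.
by rewrite unfold_in /T linearB linearZ_LR e addrK.
Qed.

(** Lifts of generators of M span a submodule that together with ker p gives all of P. *)
Lemma projective_cover_fg (P M : lmodType A) (p : {linear P -> M}) :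
  superfluous_kernel p -> surjective_lin p -> finitely_generated M -> 
  finitely_generated P.
Proof.
move=> psup pS [n [v vP]]; have [w wv] := choice (fun i => pS (v i)).
pose S : {pred P} := fun x => `[< exists a : 'I_n -> A, x = \sum_i a i *: w i >].
have Sc : GRing.submod_closed S.
  split=> [|a _ _ /asboolP[c ->] /asboolP[d ->]]; apply/asboolP.
    by exists (fun=> 0); rewrite big1 // => i _; rewrite scale0r.
  exists (fun i => a * c i + d i); rewrite scaler_sumr -big_split /=.
  by apply: eq_bigr => i _; rewrite scalerDl scalerA.
exists n, w => x; apply/asboolP; apply: (psup S Sc) => y.
have [a pa] := vP (p y); exists (\sum_i a i *: w i), (y - \sum_i a i *: w i).
split; [by apply/asboolP; exists a| |by rewrite addrC subrK].
rewrite linearB pa linear_sum.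
by under [X in _ - X]eq_bigr do rewrite linearZ_LR wv; rewrite subrr.
Qed.

Definition jacobson_val : {linear jacobson_lmod A -> A^o} := val.

Lemma jacobson_val_inj : injective jacobson_val. Proof. exact: val_inj. Qed.

Lemma jacobson_valP x : jacobson_val x \in jacobson A. Proof. exact: (valP x). Qed.

Lemma projective_of_injective_cover (P K : lmodType A) (p : {linear P -> K}) :
  projective_module P -> surjective_lin p -> (forall x, p x = 0 -> x = 0) ->
  projective_module K.
Proof. by move=> PP pS /linear_inj pI; exact: (projective_module_iso pI pS PP). Qed.

(* Write the identity of the projective cover P of K as the sum of the f_i x_i
   of a dual basis.  The f_i map L = ker p into J, so they agree on L with
   maps g_i : P -> J.  Then h, the sum of the (f_i - g_i) x_i, kills L and is
   the identity modulo JP, hence bijective by Nakayama. *)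
Lemma projective_of_ext1_jacobson K :
  finitely_generated K -> has_projective_cover K ->
  ext1_vanish K (jacobson_lmod A : lmodType A) -> projective_module K.
Proof.
move=> Kfg [P [p [PP pS psup]]] ext.
apply: (projective_of_injective_cover PP pS).
have [n [v vP]] := projective_cover_fg psup pS Kfg.
have [f fE] := fg_dual_basis PP vP.
have gex i : exists g : {linear P -> jacobson_lmod A},
    forall x, p x = 0 -> jacobson_val (g x) = f i x.
  have [f' f'E] : exists f' : {linear submod (ker_closed p) -> jacobson_lmod A},
      forall x, jacobson_val (f' x) = (f i \o submod_val _) x.
    apply: (factor_inj jacobson_val_inj) => x /=.
    have fJ : f i (submod_val _ x) \in jacobson A.
      by apply: superfluous_kernel_jacobson psup _; exact/ker_predP/submod_valP.
    by exists (exist (fun x => x \in jacobson A) _ fJ).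
  have [g gE] := ext _ _ _ _ (ker_short_exact pS) PP f'.
  exists g => x /(ker_predP p)/(submod_in (ker_closed p))[y <-].
  by rewrite gE f'E.
have [g gE] := choice gex.
have jL : linear (fun x => \sum_i (jacobson_val (g i x) : A) *: v i).
  move=> a x y; rewrite scaler_sumr -big_split /=; apply: eq_bigr => i _.
  by rewrite !linearP /= scalerDl scalerA.
pose j := mklinear jL; pose h : {linear P -> P} := idfun \- j.
have all_of_basis (S : {pred P}) : GRing.submod_closed S -> (forall i, v i \in S) ->
    forall x, x \in S.
  move=> Sc vS x; have [a ->] := vP x.
  by apply: (closed_sum Sc) => i; exact: (closedZ Sc).
have hS : surjective_lin h.
  move=> x; apply/asboolP; apply: (all_of_basis _ (im_closed h)) => {x}.
  apply: (nakayama (im_closed h)) => i.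
  exists (fun k => jacobson_val (g k (v i))); split=> [k|]; first exact: jacobson_valP.
  by apply/asboolP; exists (v i).
(* Surjectivity of h gives a section s = id + j s. It is again the identity modulo JP, hence onto by
   Nakayama, and this makes h injective. *)
have [s sK] := projective_section PP hS.
have sS : surjective_lin s.
  move=> x; apply/asboolP; apply: (all_of_basis _ (im_closed s)) => {x}.
  apply: (nakayama (im_closed s)) => i.
  exists (fun k => - (jacobson_val (g k (s (v i))) : A)); split=> [k|].
    by apply: (closedN Jc); exact: jacobson_valP.
  apply/asboolP; exists (v i).
  under eq_bigr do rewrite scaleNr.
  by rewrite sumrN opprK -{2}[v i]sK /h /= subrK.
move=> x px; have [y ys] := sS x.
have hx : h x = 0.
  rewrite -[h x]/(x - \sum_i (jacobson_val (g i x) : A) *: v i) {1}(fE x).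
  rewrite -sumrB big1 // => i _.
  by rewrite gE // subrr.
by rewrite -ys -(sK y) ys hx linear0.
Qed.
End Jacobson.

(** * Left-right symmetry of the radical and of the global dimension *)

Section LeftRight.
Variables A B : pzRingType.

(** If e(x) is outside a maximal left ideal S, write 1 = s + b e(x). Then s is the image of 1 - x b'
    with x b' in the radical, b' being the preimage of b; e turns a right inverse of this element
    into a left inverse of s, so 1 lies in S. *)
Lemma anti_jacobson (e : anti_isomorphism A B) (x : A) :
  (x : A^o) \in jacobson A -> (e x : B^o) \in jacobson B.
Proof.
move=> xJ; apply/asboolP => S Smax; apply: contrapT => /negP xS.
have [s [b [sS E]]] := maximal_submodule_sum Smax xS (1 : B).
have [u uE] := jacobson_right_inverse (jacobson_mulr (anti_inv e b) xJ).
have [Sc [z /negP zS] _] := Smax; apply: zS.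
have S1 : (1 : B^o) \in S.
  have -> : (1 : B^o) = e u *: s; last exact: (closedZ Sc).
  have -> : s = e (1 - x * anti_inv e b).
    have xb : e (x * anti_inv e b) = b * e x by rewrite antiM anti_invK.
    apply: (addIr (b * e x : B)); transitivity (1 : B); first exact: esym E.
    by rewrite -xb -antiD subrK anti1.
  by rewrite -[RHS]antiM uE anti1.
by have := closedZ Sc (z : B) S1; rewrite [_ *: _]mulr1.
Qed.

(* Both sides say that Tor_1(Y, X) = 0. *)
Lemma ext1_vanish_char (e : anti_isomorphism A B) (X : lmodType A) (Y : lmodType B) :
  ext1_vanish X (char_module e Y) -> ext1_vanish Y (char_module (anti_flip e) X).
Proof.
move=> ext; have sX := syzygy_short_exact X.
have FP := @free_projective A X.
apply: (iffRL (ext1_vanish_lift Y (char_short_exact (anti_flip e) sX) (char_injective FP))).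
move=> k; have [h hE] := char_swap_inv k.
have [g gE] := ext _ _ _ _ sX FP h.
have [u uE] := char_swap g; exists u => y; apply: chval_inj => x.
by rewrite char_mapE uE gE hE.
Qed.

(** The characters of a free presentation of Y form an injective copresentation of Y^+, so the dual
    of a syzygy of Y serves as a cosyzygy of Y^+. *)
Lemma ext1_vanish_char_syzygy (e : anti_isomorphism A B) n
    (X : lmodType A) (Y : lmodType B) :
  ext1_vanish (iter n (@syzygy A) X) (char_module e Y) ->
  ext1_vanish X (char_module e (iter n (@syzygy B) Y)).
Proof.
elim: n X => // n IH X; rewrite iterSr iterS => /IH.
apply: (iffLR (ext1_vanish_shift (syzygy_short_exact X) _
  (char_short_exact e (syzygy_short_exact _)) _)).
  exact: free_projective.
exact/char_injective/free_projective.
Qed.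

(* With L the kernel of the projective cover P of K and T = L/JL, the map
   L -> T -> T^++ extends to P.  It kills L, since L lies in JP and J kills
   T^++, while T embeds into T^++; so T = 0 and L = 0 by Nakayama. *)
Lemma projective_of_ext1_char (e : anti_isomorphism B A) (K : lmodType B) :
  noetherian_module (B^o : lmodType B) ->
  finitely_generated K -> has_projective_cover K ->
  (forall X : lmodType A, ext1_vanish K (char_module e X)) -> projective_module K.
Proof.
move=> Bnoeth Kfg [P [p [PP pS psup]]] ext.
have Jc := jacobson_submod B.
apply: (projective_of_injective_cover PP pS).
have Pfg := projective_cover_fg psup pS Kfg.
have [n [v vP]] := Pfg; have [f fE] := fg_dual_basis PP vP.
pose L : lmodType B := submod (ker_closed p).
have [m [w wP]] : finitely_generated L by exact: noetherian_fg_ker.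
(* S is JL, written on the generators w so that membership supplies the coefficients for
   [nakayama]. *)
pose S : {pred L} := fun y => `[< exists c : 'I_m -> B,
  (forall i, (c i : B^o) \in jacobson B) /\ y = \sum_i c i *: w i >].
have Sc : GRing.submod_closed S.
  split=> [|a _ _ /asboolP[c [cJ ->]] /asboolP[d [dJ ->]]]; apply/asboolP.
    exists (fun=> 0); split=> [_|]; first exact: (closed0 Jc).
    by rewrite big1 // => i _; rewrite scale0r.
  exists (fun i => a * c i + d i); split=> [i|]; first by have [_ JL] := Jc; exact: JL.
  rewrite scaler_sumr -big_split /=.
  by apply: eq_bigr => i _; rewrite scalerDl scalerA.
pose T := quot Sc : lmodType B.
have JT (b : B) (t : T) : (b : B^o) \in jacobson B -> b *: t = 0.
  move=> bJ; have [y <-] := quot_proj_surj t; rewrite -linearZ_LR.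
  apply/quot_proj_eq0/asboolP; have [a ->] := wP y.
  exists (fun i => b * a i); split=> [i|]; first exact: jacobson_mulr.
  by rewrite scaler_sumr; apply: eq_bigr => i _; rewrite scalerA.
have [j [jI _]] := char_eval e T.
have [g gE] := ext _ _ _ _ _ (ker_short_exact pS) PP (j \o quot_proj Sc).
have LS (y : L) : y \in S.
  apply/(quot_proj_eq0 Sc); apply: (inj_eq0 jI).
  rewrite -[LHS]/((j \o quot_proj Sc) y) -gE [submod_val _ y]fE linear_sum.
  rewrite big1 // => i _.
  rewrite linearZ_LR; apply: chval_inj => x; rewrite chvalZ chval0l.
  have -> : e (f i (submod_val _ y)) *: x = 0; last exact: chval0r.
  apply: chval_inj => t; rewrite chvalZ [anti_flip e _]antiK chval0l.
  rewrite JT ?chval0r //; apply: (superfluous_kernel_jacobson _ psup).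
  by apply/ker_predP; exact: submod_valP.
have zero_closed : GRing.submod_closed (fun y : L => y == 0).
  by split=> [|a x y]; rewrite !unfold_in // => /eqP -> /eqP ->; rewrite scaler0 addr0.
have w0 i : w i = 0.
  apply/eqP; apply: (nakayama zero_closed) => {}i.
  have /asboolP[c [cJ wc]] := LS (w i); exists c; split=> //.
  by rewrite unfold_in {1}wc subrr.
move=> x /(ker_predP p)/(submod_in (ker_closed p))[y <-].
have [a ->] := wP y; rewrite big1 ?linear0 // => i _.
by rewrite w0 scaler0.
Qed.

(** Writing Z^n for n-th syzygies, the hypothesis at Y^+ gives E(Z^n X, Y^+), then E(X, (Z^n Y)^+),
    then by the Tor symmetry E(Z^n Y, X^+), and finally E(K, X^+) for a finitely generated n-th
    syzygy K of Y. *)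
Lemma gl_dim_le_anti (e : anti_isomorphism A B) n :
  noetherian_module (B^o : lmodType B) ->
  (forall M : lmodType B, finitely_generated M -> has_projective_cover M) ->
  gl_dim_le A n -> gl_dim_le B n.
Proof.
move=> Bnoeth cover G; apply: gl_dim_le_fg => Y N Yfg.
have [K Kfg KY] := fg_syzygy Bnoeth n Yfg; apply/KY/ext1_vanish_projective.
apply: (projective_of_ext1_char (e := anti_flip e)) => // [|X]; first exact: cover.
apply/KY/ext1_vanish_syzygy_iter/ext1_vanish_char/ext1_vanish_char_syzygy.
exact/ext1_vanish_syzygy_iter.
Qed.
End LeftRight.

(** * The injective dimension of the radical *)

Lemma inj_dim_le_jacobson (A : pzRingType) n :
  noetherian_module (A^o : lmodType A) ->
  (forall M : lmodType A, finitely_generated M -> has_projective_cover M) ->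
  inj_dim_le n (jacobson_lmod A : lmodType A) <-> gl_dim_le A n.
Proof.
move=> Anoeth cover; split=> [Jn|]; last exact: gl_dim_le_inj.
apply: gl_dim_le_fg => X N Xfg.
have [K Kfg KX] := fg_syzygy Anoeth n Xfg; apply/KX/ext1_vanish_projective.
apply: projective_of_ext1_jacobson => //; first exact: cover.
exact/KX/inj_dim_le_ext1.
Qed.

Lemma inj_dim_le_iso (A : pzRingType) n (M N : lmodType A) (f : {linear M -> N}) :
  injective f -> surjective_lin f -> inj_dim_le n N -> inj_dim_le n M.
Proof.
case: n => [|n] fI fS /=; first exact: (injective_module_iso fI fS).
move=> [I [C [i [c [[iI cS E] II Cn]]]]]; exists I, C, (i \o f), c; split=> //.
split=> //; first exact: inj_comp.
move=> y; rewrite E; split=> [[x <-]|[x <-]]; last by exists (f x).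
by have [z <-] := fS x; exists z.
Qed.

(** One side intersects the maximal right ideals of A, the other the maximal left ideals;
    [anti_jacobson] in both directions identifies them. *)
Lemma jacobson_converse (A : pzRingType) (x : A) :
  (x : (A^c)^o) \in jacobson A^c <-> (x : (A^c)^o) \in jacobson_op A.
Proof.
split=> xJ; last exact: (anti_jacobson (anti_converse A)).
exact: (anti_jacobson (anti_flip (anti_converse A)) xJ).
Qed.

(** The two modules are subtypes of the same regular module for predicates that agree only through
    [jacobson_converse], so an isomorphism has to carry the dimension across. *)
Lemma inj_dim_jacobson_op (A : pzRingType) :
  inj_dim (jacobson_rmod A : lmodType A^c) = inj_dim (jacobson_lmod A^c : lmodType A^c).
Proof.
have vI : injective (val : jacobson_rmod A -> (A^c)^o) by exact: val_inj.
have [f fE] : exists f : {linear jacobson_rmod A -> jacobson_lmod A^c},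
    forall x, jacobson_val A^c (f x) = (val : {linear jacobson_rmod A -> (A^c)^o}) x.
  apply: (factor_inj (@jacobson_val_inj _)) => x.
  have xJ : val x \in jacobson A^c by apply/jacobson_converse; exact: (valP x).
  by exists (exist (fun x => x \in jacobson A^c) _ xJ).
have fI : injective f by move=> x y e; apply: vI; rewrite -!fE e.
have fS : surjective_lin f.
  move=> y; have yJ : jacobson_val A^c y \in jacobson_op A.
    by apply/jacobson_converse; exact: jacobson_valP.
  exists (exist (fun x => x \in jacobson_op A) _ yJ).
  by apply: jacobson_val_inj; rewrite fE.
have [g [fK gK]] := linear_inverse fI fS.
rewrite !inj_dimE; congr least; apply/funext => n; apply/propext; split.
  apply: (inj_dim_le_iso (f := g)); first exact: can_inj gK.
  by move=> x; exists (f x).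
exact: inj_dim_le_iso fI fS.
Qed.

Theorem theorem2p6 (A : pzRingType)
  (hsemiperfect : semiperfect_ring A) (hnoetherian : noetherian_ring A) :
  inj_dim (jacobson_lmod A : lmodType A) = gl_dim A /\
  inj_dim (jacobson_lmod A : lmodType A)
    = inj_dim (jacobson_rmod A : lmodType A^c).
Proof.
have [cover cover_op] := hsemiperfect; have [noeth noeth_op] := hnoetherian.
have JA : inj_dim (jacobson_lmod A : lmodType A) = gl_dim A.
  rewrite inj_dimE gl_dimE; congr least; apply/funext => n; apply/propext.
  exact: inj_dim_le_jacobson.
(* With [inj_dim_le_jacobson] for A^c, what remains is to compare the global dimensions of A and
   A^c. *)
split=> //; rewrite inj_dim_jacobson_op JA inj_dimE gl_dimE.
congr least; apply/funext => n; apply/propext.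
split=> [/(gl_dim_le_anti (anti_converse A) noeth_op cover_op)|].
  by move/inj_dim_le_jacobson; apply.
move/inj_dim_le_jacobson => /(_ noeth_op cover_op).
exact: (gl_dim_le_anti (anti_flip (anti_converse A)) noeth cover).
Qed.
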